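(* Let $(H,R)$ be a quasitriangular Hopf algebra over a field $k$ and let $L=R_{(l)}=\{(id\otimes p)(R)\mid p\in H^*\}$, a finite dimensional Hopf subalgebra of $H$. Let $V$ be a quantum commutative left $H$-module algebra, with action $H\otimes V\to V$, $h\otimes v\mapsto h\cdot v$. Then the smash product $V\#L$ is (carries the structure of) a Hopf algebroid over $V$, i.e. with total algebra $V\#L$ and base algebra $V$, where the left action of $L$ on $V$ is the one induced from the action of $H$ on $V$ by the inclusion $L\subseteq H$.
   Context: $\Delta(h)=\sum h_1\otimes h_2$. Quasitriangular: $R=\sum R^1\otimes R^2\in H\otimes H$ is invertible with $(\Delta\otimes id)(R)=R_{13}R_{23}$, $(id\otimes\Delta)(R)=R_{13}R_{12}$, $\Delta^{cop}(h)R=R\Delta(h)$. A left $H$-module algebra $V$ is quantum commutative if $vw=\sum(R^2\cdot w)(R^1\cdot v)$ for all $v,w\in V$. The smash product $V\#L$ is $V\otimes L$ with product $(v\#l)(w\#l')=\sum v(l_1\cdot w)\#l_2l'$. Bialgebroid (Lu): consists of 1) an algebra $T$ (total algebra) and an algebra $B$ (base algebra); 2) an algebra homomorphism $\alpha:B\to T$ (source) and an algebra anti-homomorphism $\beta:B\to T$ (target) with $\alpha(b)\beta(b')=\beta(b')\alpha(b)$ for all $b,b'\in B$; $T$ is then a $B$-$B$-bimodule with left structure map $\lambda(b\otimes t)=\alpha(b)t$ and right structure map $\rho(t\otimes b)=\beta(b)t$, and $\otimes_B$ is formed with respect to this bimodule structure; 3) a coproduct: a $B$-$B$-bimodule map $\Delta:T\to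 T\otimes_BT$ with $\Delta(1)=1\otimes 1$ and $(\Delta\otimes_B id_T)\Delta=(id_T\otimes_B\Delta)\Delta$, such that the kernel of the map $\phi:T\otimes T\otimes T\to T\otimes_BT$, $t\otimes t'\otimes t''\mapsto\Delta(t)(t'\otimes t'')$, is a left ideal of $T\otimes T^{op}\otimes T^{op}$ (here $T\otimes T$ acts on $T\otimes_BT$ from the right by right multiplication); 4) a counit: a $B$-$B$-bimodule map $\varepsilon:T\to B$ with $\varepsilon(1)=1$, $\lambda(\varepsilon\otimes id_T)\Delta=\rho(id_T\otimes\varepsilon)\Delta=id_T$, and such that $\ker\varepsilon$ is a left ideal of $T$. Hopf algebroid (= quantum groupoid): a bialgebroid $T$ over $B$ together with a linear map $\tau:T\to T$ (antipode) such that: $\tau$ is an algebra anti-isomorphism; $\tau\beta=\alpha$; $m_T(\tau\otimes id)\Delta=\beta\varepsilon\tau:T\to T$, where $m_T$ is the multiplication of $T$; and there exists a linear map $\gamma:T\otimes_BT\to T\otimes T$ which is a section of the natural projection $T\otimes T\to T\otimes_BT$ and satisfies $m_T(id\otimes\tau)\gamma\Delta=\alpha\varepsilon:T\to T$. *)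

(* Defs.v *)
From HB Require Import structures.
From mathcomp Require Import all_boot all_algebra.
From mathcomp Require Import boolp classical_sets.
From mathcomp.multinomials Require Import freeg.

Set Implicit Arguments.
Unset Strict Implicit.
Unset Printing Implicit Defensive.

Import GRing.Theory.
Local Open Scope ring_scope.
Local Open Scope quotient_scope.

Section Opposite.
Variables (k : fieldType) (A : algType k).
HB.instance Definition _ := GRing.Zmodule_isLmodule.Build k (A^c)
  (@scalerA k A) (@scale1r k A) (@scalerDr k A) (fun v a b => @scalerDl k A v a b).
HB.instance Definition _ := GRing.Lmodule_isLalgebra.Build k (A^c)
  (fun a u v => @scalerAr k A a v u).
HB.instance Definition _ := GRing.Lalgebra_isAlgebra.Build k (A^c)
  (fun a u v => @scalerAl k A a v u).
End Opposite.

Section QuotientModule.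
Variables (k : fieldType) (W : lmodType k) (P : W -> Prop).

Definition lspan : {pred W} := fun x =>
  `[< exists s : seq (k * W),
      (forall p, p \in s -> P p.2) /\ x = \sum_(p <- s) p.1 *: p.2 >].

Lemma lspan_gen x : P x -> x \in lspan.
Proof.
move=> Px; apply/asboolP; exists [:: (1, x)]; split; last first.
  by rewrite big_seq1 scale1r.
by move=> p; rewrite inE => /eqP->.
Qed.

Lemma lspan_submod : submod_closed lspan.
Proof.
split=> [|a x y /asboolP[s [sP ->]] /asboolP[t [tP ->]]]; apply/asboolP.
  by exists [::]; rewrite big_nil.
exists ([seq (a * p.1, p.2) | p <- s] ++ t); split=> [p|].
  by rewrite mem_cat => /orP[/mapP[q /sP + ->]|/tP].
rewrite big_cat big_map /= scaler_sumr; congr (_ + _).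
by apply: eq_bigr => p _; rewrite scalerA.
Qed.

HB.instance Definition _ := GRing.isSubmodClosed.Build k W lspan lspan_submod.

Definition quotmod := Quotient.quot lspan.
HB.instance Definition _ := ZmodQuotient.on quotmod.

Definition qscale (a : k) (x : quotmod) : quotmod := \pi_quotmod (a *: repr x).

Lemma quot_eq (x y : W) : x - y \in lspan -> \pi_quotmod x = \pi_quotmod y.
Proof. by rewrite Quotient.idealrBE => /eqP. Qed.

Lemma repr_pi_span (x : W) : repr (\pi_quotmod x) - x \in lspan.
Proof. by rewrite Quotient.idealrBE reprK. Qed.

Lemma qscale_pi a x : qscale a (\pi_quotmod x) = \pi_quotmod (a *: x).
Proof. by apply: quot_eq; rewrite -scalerBr rpredZ // repr_pi_span. Qed.

Lemma qscaleA a b x : qscale a (qscale b x) = qscale (a * b) x.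
Proof. by elim/quotW: x => x; rewrite (qscale_pi b) !qscale_pi scalerA. Qed.
Lemma qscale1 x : qscale 1 x = x.
Proof. by elim/quotW: x => x; rewrite qscale_pi scale1r. Qed.
Lemma qscaleDr a : {morph qscale a : x y / x + y}.
Proof.
elim/quotW=> x; elim/quotW=> y.
by rewrite -raddfD !qscale_pi scalerDr raddfD.
Qed.
Lemma qscaleDl x : {morph qscale^~ x : a b / a + b}.
Proof. by elim/quotW: x => x a b; rewrite !qscale_pi scalerDl raddfD. Qed.

HB.instance Definition _ := GRing.Zmodule_isLmodule.Build k quotmod
  qscaleA qscale1 qscaleDr qscaleDl.

Definition qproj (x : W) : quotmod := \pi_quotmod x.

Lemma qproj_linear : linear qproj.
Proof. by move=> a x y; rewrite /qproj raddfD; congr (_ + _); exact/esym/qscale_pi. Qed.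
HB.instance Definition _ := GRing.isLinear.Build k W quotmod _ qproj qproj_linear.

Lemma qprojK (x : quotmod) : qproj (repr x) = x.
Proof. exact: reprK. Qed.

Lemma qproj_gen x : P x -> qproj x = 0.
Proof.
by move=> /lspan_gen Px; rewrite -[RHS](linear0 qproj); apply: quot_eq; rewrite subr0.
Qed.

(* [F] factors through the quotient *)
Lemma quot_lift (X : lmodType k) (F : {linear W -> X}) :
  (forall x, P x -> F x = 0) -> forall x, F (repr (qproj x)) = F x.
Proof.
move=> FP x; apply/eqP; rewrite -subr_eq0 -linearB; apply/eqP.
have /asboolP[s [sP ->]] := repr_pi_span x.
rewrite linear_sum big_seq big1 // => p /sP /FP Fp.
by rewrite linearZ /= Fp scaler0.
Qed.

End QuotientModule.

Section Tensor.
Variables (k : fieldType) (U V : lmodType k).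

Notation "<< u ; v >>" := (Freeg [:: (1 : k, (u, v))]) (at level 0).

Variant tens_rel : {freeg (U * V)%type / k} -> Prop :=
| TensDl u u' v : tens_rel (<< u + u'; v >> - << u; v >> - << u'; v >>)
| TensDr u v v' : tens_rel (<< u; v + v' >> - << u; v >> - << u; v' >>)
| TensZl a u v : tens_rel (<< a *: u; v >> - a *: << u; v >>)
| TensZr a u v : tens_rel (<< u; a *: v >> - a *: << u; v >>).

Definition tens := quotmod tens_rel.
HB.instance Definition _ := GRing.Lmodule.on tens.
Definition tensor (u : U) (v : V) : tens := qproj tens_rel << u; v >>.

Definition bilin (X : lmodType k) (f : U -> V -> X) :=
  (forall v, linear (f^~ v)) /\ (forall u, linear (f u)).

(* The linear map U (x) V -> X induced by [f]; meaningful when [f] is bilinear. *)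
Definition tlift (X : lmodType k) (f : U -> V -> X) (x : tens) : X :=
  fglift (fun p => f p.1 p.2) (repr x).


Lemma tensDl u u' v : tensor (u + u') v = tensor u v + tensor u' v.
Proof.
apply/eqP; rewrite -subr_eq0 opprD addrA -!linearB; apply/eqP.
exact/qproj_gen/TensDl.
Qed.

Lemma tensDr u v v' : tensor u (v + v') = tensor u v + tensor u v'.
Proof.
apply/eqP; rewrite -subr_eq0 opprD addrA -!linearB; apply/eqP.
exact/qproj_gen/TensDr.
Qed.

Lemma tensZl a u v : tensor (a *: u) v = a *: tensor u v.
Proof.
apply/eqP; rewrite -subr_eq0 -linearZ -linearB; apply/eqP.
exact/qproj_gen/TensZl.
Qed.

Lemma tensZr a u v : tensor u (a *: v) = a *: tensor u v.
Proof.
apply/eqP; rewrite -subr_eq0 -linearZ -linearB; apply/eqP.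
exact/qproj_gen/TensZr.
Qed.

Lemma tensor_bilin : bilin tensor.
Proof.
by split=> [v a u u' | u a v v'] /=; rewrite (tensDl, tensDr) (tensZl, tensZr).
Qed.

Lemma tens_ind (Q : tens -> Prop) :
  (forall u v, Q (tensor u v)) -> (forall x y, Q x -> Q y -> Q (x + y)) ->
  forall x, Q x.
Proof.
move=> Qt QD x; rewrite -[x]qprojK -[repr x]freeg_sumE linear_sum.
have Q0 : Q 0 by have := Qt 0 0; rewrite -(scale0r (0 : U)) tensZl scale0r.
apply: big_ind => // -[u v] _.
suff -> : << coeff (u, v) (repr x) *g (u, v) >> = coeff (u, v) (repr x) *: << u; v >>.
  by rewrite linearZ; have := Qt (coeff (u, v) (repr x) *: u) v; rewrite tensZl.
by apply/eqP/freeg_eqP => z; rewrite coeffZ !coeffU mul1r.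
Qed.

Section Lift.
Variables (X : lmodType k).
Implicit Types f g : U -> V -> X.

Definition flift f : {freeg (U * V)%type / k} -> X := fglift (fun p => f p.1 p.2).

HB.instance Definition _ f := GRing.isZmodMorphism.Build _ _ (flift f)
  (lift_is_additive (fun p => f p.1 p.2)).

Lemma fliftE f D : flift f D = \sum_(p <- dom D) coeff p D *: f p.1 p.2.
Proof.
rewrite -{1}[D]freeg_sumE raddf_sum; apply: eq_bigr => p _ /=.
exact: liftU.
Qed.

Lemma tlift_sum f x :
  tlift f x = \sum_(p <- dom (repr x)) coeff p (repr x) *: f p.1 p.2.
Proof. exact: fliftE. Qed.

Lemma flift_linear f : linear (flift f).
Proof.
move=> a D E; rewrite raddfD; congr (_ + _).
rewrite -{1}[D]freeg_sumE scaler_sumr raddf_sum fliftE scaler_sumr.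
apply: eq_bigr => p _ /=; rewrite /flift.
have -> : a *: << coeff p D *g p >> = << a * coeff p D *g p >>.
  by apply/eqP/freeg_eqP => z; rewrite coeffZ !coeffU mulrA.
by rewrite !liftU scalerA.
Qed.
HB.instance Definition _ f := GRing.isLinear.Build k _ X _ (flift f) (flift_linear f).

Lemma flift1 f u v : flift f << u; v >> = f u v.
Proof. by rewrite /flift liftU scale1r. Qed.

Lemma bilinDl f u u' v : bilin f -> f (u + u') v = f u v + f u' v.
Proof. by case=> fl _; have := fl v 1 u u'; rewrite !scale1r. Qed.
Lemma bilinDr f u v v' : bilin f -> f u (v + v') = f u v + f u v'.
Proof. by case=> _ fr; have := fr u 1 v v'; rewrite !scale1r. Qed.
Lemma bilinZl f a u v : bilin f -> f (a *: u) v = a *: f u v.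
Proof.
move=> fb; have f0 : f 0 v = 0 by apply: (addIr (f 0 v)); rewrite -bilinDl // !add0r.
by case: fb => fl _; have /= := fl v a u 0; rewrite f0 !addr0.
Qed.
Lemma bilinZr f a u v : bilin f -> f u (a *: v) = a *: f u v.
Proof.
move=> fb; have f0 : f u 0 = 0 by apply: (addIr (f u 0)); rewrite -bilinDr // !add0r.
by case: fb => _ fr; have /= := fr u a v 0; rewrite f0 !addr0.
Qed.

Lemma flift_rel f : bilin f -> forall x, tens_rel x -> flift f x = 0.
Proof.
move=> fb x []=> *; rewrite !linearB ?linearZ /= !flift1.
- by rewrite bilinDl // addrAC addrK subrr.
- by rewrite bilinDr // addrAC addrK subrr.
- by rewrite bilinZl // scalerN subrr.
- by rewrite bilinZr // scalerN subrr.
Qed.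

Lemma tlift_pi f D : bilin f -> tlift f (qproj tens_rel D) = flift f D.
Proof. by move=> fb; exact: (quot_lift (flift_rel fb)). Qed.

Lemma tliftE f u v : bilin f -> tlift f (tensor u v) = f u v.
Proof. by move=> fb; rewrite tlift_pi // flift1. Qed.

Lemma tlift_linear f : bilin f -> linear (tlift f).
Proof.
move=> fb a x y; rewrite -[x]qprojK -[y]qprojK -linearP !tlift_pi //.
exact: linearP.
Qed.

Lemma tliftD f x y : bilin f -> tlift f (x + y) = tlift f x + tlift f y.
Proof. by move=> fb; have := tlift_linear fb 1 x y; rewrite !scale1r. Qed.

Lemma tliftZ f a x : bilin f -> tlift f (a *: x) = a *: tlift f x.
Proof.
move=> fb; have f0 : tlift f 0 = 0 by apply: (addIr (tlift f 0)); rewrite -tliftD // !add0r.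
by have := tlift_linear fb a x 0; rewrite f0 !addr0.
Qed.

Lemma tlift0 f : bilin f -> tlift f 0 = 0.
Proof. by move=> fb; have := tliftZ 0 0 fb; rewrite !scale0r. Qed.

Lemma eq_tlift f g : (forall u v, f u v = g u v) -> tlift f =1 tlift g.
Proof.
move=> fg x; rewrite /tlift -/(flift f _) -/(flift g _) !fliftE.
by apply: eq_bigr => p _; rewrite fg.
Qed.

(* No bilinearity is needed for linearity in a parameter. *)
Lemma tlift_linear_param (Y : lmodType k) (F : Y -> U -> V -> X) x :
  (forall u v, linear (fun y => F y u v)) -> linear (fun y => tlift (F y) x).
Proof.
move=> Fl a y z; rewrite /tlift -!/(flift _ _) !fliftE scaler_sumr -big_split /=.
by apply: eq_bigr => p _; rewrite Fl scalerDr !scalerA mulrC.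
Qed.

End Lift.

Lemma tlift_comp (X Y : lmodType k) (h : {linear X -> Y}) (f : U -> V -> X) x :
  h (tlift f x) = tlift (fun u v => h (f u v)) x.
Proof.
rewrite /tlift -/(flift f _) -/(flift (fun u v => h (f u v)) _) !fliftE linear_sum.
by apply: eq_bigr => p _; rewrite linearZ.
Qed.

End Tensor.

Arguments tens {k} (U V)%_type_scope.
Notation "U ⊗ V" := (tens U V) (at level 40, left associativity) : type_scope.
Notation "u ⊗ v" := (tensor u v) (at level 40, left associativity) : ring_scope.

Lemma bilin_tens (k : fieldType) (U V X Y : lmodType k) (f : U -> X) (g : V -> Y) :
  linear f -> linear g -> bilin (fun u v => f u ⊗ g v).
Proof.
move=> fl gl; split=> [v a u u' | u a v v'] /=.
  by rewrite fl tensDl tensZl.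
by rewrite gl tensDr tensZr.
Qed.

Lemma tlift_tlift (k : fieldType) (U V U' V' X : lmodType k)
    (f : U' -> V' -> X) (g : U -> V -> U' ⊗ V') x :
  bilin f -> tlift f (tlift g x) = tlift (fun u v => tlift f (g u v)) x.
Proof.
move=> fb; pose fL := GRing.isLinear.Build k _ X _ (tlift f) (tlift_linear fb).
pose F : {linear (U' ⊗ V')%type -> X} := HB.pack (tlift f) fL.
exact: (tlift_comp F).
Qed.

Lemma exchange_tlift (k : fieldType) (U V U' V' X : lmodType k)
    (f : U -> V -> U' -> V' -> X) x y :
  tlift (fun u v => tlift (f u v) y) x = tlift (fun u' v' => tlift (fun u v => f u v u' v') x) y.
Proof.
rewrite !tlift_sum.
under eq_bigr do rewrite tlift_sum scaler_sumr.
under [RHS]eq_bigr do rewrite tlift_sum scaler_sumr.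
rewrite exchange_big; apply: eq_bigr => q _; apply: eq_bigr => p _ /=.
by rewrite !scalerA mulrC.
Qed.

Section TensorMaps.
Variable k : fieldType.

(* f (x) g *)
Definition tmap (U V X Y : lmodType k) (f : U -> X) (g : V -> Y) : U ⊗ V -> X ⊗ Y :=
  tlift (fun u v => f u ⊗ g v).

Definition tassoc (U V W : lmodType k) : U ⊗ (V ⊗ W) -> (U ⊗ V) ⊗ W :=
  tlift (fun u => tlift (fun v w => (u ⊗ v) ⊗ w)).

Definition tswap (U V : lmodType k) : U ⊗ V -> V ⊗ U := tlift (fun u v => v ⊗ u).

End TensorMaps.

Section Functional.
Variables (k : fieldType) (U : lmodType k) (u : U).
Local Open Scope classical_set_scope.

Lemma functional_ex : u != 0 -> exists f : {scalar U}, f u = 1.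
Proof.
move=> u0.
pose P (A : set U) := (forall a x y, A x -> A y -> A (a *: x + y)) /\ ~ A u.
have [|A [[Al Au] Amax]] := @Zorn_bigcup U P.
  move=> F FP Ft; split=> [a x y [B FB Bx] [C FC Cy]|[B FB Bu]]; last first.
    by have [_ ] := FP _ FB.
  have [BC|CB] := Ft _ _ FB FC.
    by exists C => //; apply: (FP _ FC).1 => //; apply: BC.
  by exists B => //; apply: (FP _ FB).1 => //; apply: CB.
have A0 : A 0.
  apply: contrapT => nA0; apply: (Amax [set 0]).
    split; last by move=> sub0; apply: nA0; exact: sub0.
    move=> x Ax; exfalso; apply: nA0.
    by have := Al (-1) x x Ax Ax; rewrite scaleN1r addNr.
  by split=> [a x y -> ->|/eqP]; [rewrite scaler0 addr0 | exact/negP].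
have AZ a x : A x -> A (a *: x) by move=> Ax; rewrite -[_ *: _]addr0; exact: Al.
have AD x y : A x -> A y -> A (x + y) by move=> Ax Ay; rewrite -[x]scale1r; exact: Al.
have AN x : A x -> A (- x) by rewrite -scaleN1r; exact: AZ.
have dec x : exists a, A (x - a *: u).
  apply: contrapT => nx; have nAx : ~ A x.
    by move=> Ax; apply: nx; exists 0; rewrite scale0r subr0.
  apply: (Amax [set z | exists a, A (z - a *: x)]).
    split; first by move=> z Az; exists 0; rewrite scale0r subr0.
    by move=> /(_ x) /= H; apply: nAx; apply: H; exists 1; rewrite scale1r subrr.
  split=> [a y z [b Ab] [c Ac]|[b Ab]].
    exists (a * b + c).
    have -> : a *: y + z - (a * b + c) *: x = a *: (y - b *: x) + (z - c *: x).
      by rewrite scalerBr scalerDl scalerA opprD addrACA.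
    exact: Al.
  have [b0|b0] := eqVneq b 0; first by apply: Au; move: Ab; rewrite b0 scale0r subr0.
  apply: nx; exists b^-1; rewrite -opprB; apply: AN.
  have -> : b^-1 *: u - x = b^-1 *: (u - b *: x).
    by rewrite scalerBr scalerA mulVf // scale1r.
  exact: AZ.
pose f x := xget 0 [set a | A (x - a *: u)].
have fP x : A (x - f x *: u).
  by rewrite /f; case: xgetP => [a _ //|nA]; have [a /nA] := dec x.
have funiq x a : A (x - a *: u) -> f x = a.
  move=> Aa; apply/eqP; rewrite -subr_eq0; apply: contrapT => /negP ne.
  apply: Au; rewrite -[u]scale1r -(mulVf ne) -scalerA; apply: AZ.
  have -> : (f x - a) *: u = (x - a *: u) - (x - f x *: u).
    by rewrite scalerBl opprB [RHS]addrC addrA subrK.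
  exact/AD/AN.
have fl : scalar f.
  move=> a x y; apply: funiq.
  have -> : a *: x + y - (a * f x + f y) *: u
          = a *: (x - f x *: u) + (y - f y *: u).
    by rewrite scalerBr scalerDl scalerA opprD addrACA.
  exact: Al.
pose fL := GRing.isLinear.Build k U k _ f fl.
pose F : {scalar U} := HB.pack f fL.
exists F.
by apply: funiq; rewrite scale1r subrr.
Qed.

End Functional.

Section TensorAlgebra.
Variables (k : fieldType) (A B : algType k).

Definition tmul (x y : A ⊗ B) : A ⊗ B :=
  tlift (fun a b => tlift (fun a' b' => (a * a') ⊗ (b * b')) y) x.

Lemma tmul_bilin1 (a : A) (b : B) : bilin (fun a' b' => (a * a') ⊗ (b * b')).
Proof.
split=> [v c u u'|u c v v'] /=; rewrite mulrDr -scalerAr.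
  by rewrite tensDl tensZl.
by rewrite tensDr tensZr.
Qed.

Lemma tmul_bilin2 (y : A ⊗ B) :
  bilin (fun a b => tlift (fun a' b' => (a * a') ⊗ (b * b')) y).
Proof.
split=> [b | a]; apply: tlift_linear_param => a' b' c u v /=.
  by rewrite mulrDl -scalerAl tensDl tensZl.
by rewrite mulrDl -scalerAl tensDr tensZr.
Qed.

Lemma tmulE a b a' b' : tmul (a ⊗ b) (a' ⊗ b') = (a * a') ⊗ (b * b').
Proof. by rewrite /tmul tliftE ?tliftE //; [exact: tmul_bilin1|exact: tmul_bilin2]. Qed.

Lemma tmul_linl y : linear (tmul^~ y).
Proof. exact/tlift_linear/tmul_bilin2. Qed.

Lemma tmul_linr x : linear (tmul x).
Proof.
apply: tlift_linear_param => a b; exact/tlift_linear/tmul_bilin1.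
Qed.

Lemma tmulDl : left_distributive tmul +%R.
Proof. by move=> x y z; have := tmul_linl z 1 x y; rewrite !scale1r. Qed.
Lemma tmulDr : right_distributive tmul +%R.
Proof. by move=> x y z; have := tmul_linr x 1 y z; rewrite !scale1r. Qed.

Lemma tmulA : associative tmul.
Proof.
move=> x y z; elim/tens_ind: x => [a b|x x' Hx Hx']; last by rewrite !tmulDl Hx Hx'.
elim/tens_ind: y => [a' b'|y y' Hy Hy']; last by rewrite tmulDl !tmulDr tmulDl Hy Hy'.
elim/tens_ind: z => [a'' b''|z z' Hz Hz']; last by rewrite !tmulDr Hz Hz'.
by rewrite !tmulE !mulrA.
Qed.
Lemma tmul1 : left_id (1 ⊗ 1) tmul.
Proof.
by elim/tens_ind => [a b|x x' Hx Hx']; rewrite ?tmulE ?mul1r // tmulDr Hx Hx'.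
Qed.
Lemma tmulr1 : right_id (1 ⊗ 1) tmul.
Proof.
by elim/tens_ind => [a b|x x' Hx Hx']; rewrite ?tmulE ?mulr1 // tmulDl Hx Hx'.
Qed.

Lemma tone_neq0 : (1 : A) ⊗ (1 : B) != 0.
Proof.
have [f f1] := functional_ex (oner_neq0 A); have [g g1] := functional_ex (oner_neq0 B).
have fg : bilin (fun a b => f a * g b : k^o).
  split=> [v c u u'|u c v v'] /=.
    by rewrite linearP mulrDl; congr (_ + _); exact/esym/mulrA.
  by rewrite linearP mulrDr; congr (_ + _); exact: mulrCA.
apply/eqP => E; have := tliftE 1 1 fg.
by rewrite E f1 g1 mulr1 tlift0 // => /eqP; rewrite eq_sym oner_eq0.
Qed.

HB.instance Definition _ := GRing.Zmodule_isNzRing.Build (A ⊗ B)%type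
  tmulA tmul1 tmulr1 tmulDl tmulDr tone_neq0.

Lemma tscaleAl (c : k) (x y : A ⊗ B) : c *: (x * y) = c *: x * y.
Proof. by have := tmul_linl y c x 0; rewrite (mul0r y : tmul 0 y = 0) !addr0. Qed.
Lemma tscaleAr (c : k) (x y : A ⊗ B) : c *: (x * y) = x * (c *: y).
Proof. by have := tmul_linr x c y 0; rewrite (mulr0 x : tmul x 0 = 0) !addr0. Qed.

HB.instance Definition _ := GRing.Lmodule_isLalgebra.Build k (A ⊗ B)%type tscaleAl.
HB.instance Definition _ := GRing.Lalgebra_isAlgebra.Build k (A ⊗ B)%type tscaleAr.

Lemma tens_mulE (a a' : A) (b b' : B) : (a ⊗ b) * (a' ⊗ b') = (a * a') ⊗ (b * b').
Proof. exact: tmulE. Qed.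

Lemma tlift_mul (X : lmodType k) (f : A -> B -> X) (x y : A ⊗ B) : bilin f ->
  tlift f (x * y) = tlift (fun a b => tlift (fun a' b' => f (a * a') (b * b')) y) x.
Proof.
move=> fb; rewrite [x * y]/(tmul x y) /tmul tlift_tlift //.
apply: eq_tlift => a b; rewrite tlift_tlift //.
by apply: eq_tlift => a' b'; rewrite tliftE.
Qed.

End TensorAlgebra.

(* Sweedler sums are written with [tlift]: [tlift (fun x y => e) (comul h)]   *)
(* is the sum of e over comul h = sum x (x) y.                                *)
Record hopf_algebra (k : fieldType) (H : algType k) := HopfAlgebra {
  comul : {lrmorphism H -> (H ⊗ H)%type};
  counit : {lrmorphism H -> k^o};
  antip : {linear H -> H};
  comulA : forall h,
    tmap comul id (comul h) = tassoc (tmap id comul (comul h));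
  counit_l : forall h, tlift (fun x y => counit x *: y) (comul h) = h;
  counit_r : forall h, tlift (fun x y => counit y *: x) (comul h) = h;
  antip_l : forall h, tlift (fun x y => antip x * y) (comul h) = (counit h)%:A;
  antip_r : forall h, tlift (fun x y => x * antip y) (comul h) = (counit h)%:A
}.

Section Coassociativity.
Variables (k : fieldType) (H : algType k) (hH : hopf_algebra H) (X : lmodType k).
Variable F : H -> H -> H -> X.
Hypotheses (F1 : forall y z, linear (fun x => F x y z))
  (F2 : forall x z, linear (fun y => F x y z)) (F3 : forall x y, linear (F x y)).

Lemma tlift_coassoc h :
  tlift (fun x y => tlift (fun a b => F a b y) (comul hH x)) (comul hH h) =
  tlift (fun x y => tlift (F x) (comul hH y)) (comul hH h).
Proof.
pose G := tlift (fun (y : (H ⊗ H)%type) c => tlift (fun a b => F a b c) y).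
have Fb12 c : bilin (fun a b => F a b c) by split=> *; [exact: F1|exact: F2].
have Gb : bilin (fun (y : (H ⊗ H)%type) c => tlift (fun a b => F a b c) y).
  split=> [c|y]; first exact: tlift_linear.
  by apply: tlift_linear_param => a b; exact: F3.
have id_lin : linear (@id H) by [].
have t1 : bilin (fun x y : H => comul hH x ⊗ y).
  by apply: (bilin_tens _ id_lin); exact: linearP.
have t2 : bilin (fun x y : H => x ⊗ comul hH y).
  by apply: (bilin_tens id_lin); exact: linearP.
have tab (x : H) : bilin (fun v w : H => (x ⊗ v) ⊗ w).
  by apply: (bilin_tens _ id_lin) => a v w; rewrite tensDr tensZr.
have ta : bilin (fun x : H => tlift (fun v w : H => (x ⊗ v) ⊗ w)).
  split=> [y|x]; last exact: tlift_linear.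
  by apply: tlift_linear_param => v w a x x'; rewrite tensDl tensZl tensDl tensZl.
have := congr1 G (comulA hH h).
rewrite /tassoc (tlift_tlift _ _ ta) /G /tmap !(tlift_tlift _ _ Gb) => E.
transitivity (tlift (fun u v : H => tlift (fun (y : (H ⊗ H)%type) c =>
   tlift (fun a b => F a b c) y) (comul hH u ⊗ v)) (comul hH h)).
  by apply: eq_tlift => x y; rewrite tliftE.
rewrite {}E; apply: eq_tlift => x y; rewrite tliftE // tlift_tlift //.
by apply: eq_tlift => v w; rewrite tliftE // tliftE.
Qed.

End Coassociativity.

Section Quasitriangular.
Variables (k : fieldType) (H : algType k) (hH : hopf_algebra H).
Implicit Type R : (H ⊗ H)%type.

Definition R12 R : (H ⊗ H ⊗ H)%type := R ⊗ 1.
Definition R13 R : (H ⊗ H ⊗ H)%type := tlift (fun a b => (a ⊗ 1) ⊗ b) R.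
Definition R23 R : (H ⊗ H ⊗ H)%type := tlift (fun a b => (1 ⊗ a) ⊗ b) R.

Definition quasitriangular R :=
  [/\ exists R', R * R' = 1 /\ R' * R = 1,
      tmap (comul hH) id R = R13 R * R23 R,
      tassoc (tmap id (comul hH) R) = R13 R * R12 R &
      forall h, tswap (comul hH h) * R = R * comul hH h].

(* R_(l), the set of all (id (x) p)(R) with p in the dual of H *)
Definition Rl R (x : H) : Prop :=
  exists p : {scalar H}, x = tlift (fun a b => p b *: a) R.

End Quasitriangular.

Definition finite_dim (k : fieldType) (L : lmodType k) : Prop :=
  exists n (f : {linear L -> 'rV[k]_n}), bijective f.

Record hopf_morphism (k : fieldType) (L H : algType k)
  (hL : hopf_algebra L) (hH : hopf_algebra H) (i : {lrmorphism L -> H}) : Prop := {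
  morph_comul : forall l, comul hH (i l) = tmap i i (comul hL l);
  morph_counit : forall l, counit hH (i l) = counit hL l;
  morph_antip : forall l, antip hH (i l) = i (antip hL l)
}.

(* A structure of Hopf subalgebra of H on the subset P: a Hopf algebra        *)
(* [hs_alg] whose inclusion map [hs_incl] into H is a Hopf algebra morphism,  *)
(* injective with image P.                                                    *)
Record hopf_subalgebra (k : fieldType) (H : algType k) (hH : hopf_algebra H)
  (P : H -> Prop) := HopfSubalgebra {
  hs_alg :> algType k;
  hs_hopf : hopf_algebra hs_alg;
  hs_incl : {lrmorphism hs_alg -> H};
  hs_morph : hopf_morphism hs_hopf hH hs_incl;
  hs_inj : injective hs_incl;
  hs_image : forall x, P x <-> exists l, x = hs_incl l
}.

Record module_algebra (k : fieldType) (H : algType k) (hH : hopf_algebra H)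
  (V : algType k) := ModuleAlgebra {
  act : H -> V -> V;
  act_bilin : bilin act;
  act1 : forall v, act 1 v = v;
  actM : forall g h v, act (g * h) v = act g (act h v);
  act_mul : forall h v w,
    act h (v * w) = tlift (fun x y => act x v * act y w) (comul hH h);
  act_one : forall h, act h 1 = (counit hH h)%:A
}.

Definition quantum_commutative (k : fieldType) (H : algType k) (hH : hopf_algebra H)
    (R : (H ⊗ H)%type) (V : algType k) (aV : module_algebra hH V) : Prop :=
  forall v w : V, v * w = tlift (fun r1 r2 => act aV r2 w * act aV r1 v) R.

Section Restriction.
Variables (k : fieldType) (L H : algType k).
Variables (hL : hopf_algebra L) (hH : hopf_algebra H) (i : {lrmorphism L -> H}).
Hypothesis hi : hopf_morphism hL hH i.
Variables (V : algType k) (aV : module_algebra hH V).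

Definition res_act (l : L) (v : V) : V := act aV (i l) v.

Lemma res_act_bilin : bilin res_act.
Proof.
have [al ar] := act_bilin aV; split=> [v|l]; last exact: ar.
by move=> c x y; rewrite /res_act linearP al.
Qed.
Lemma res_act1 v : res_act 1 v = v.
Proof. by rewrite /res_act rmorph1 act1. Qed.
Lemma res_actM g h v : res_act (g * h) v = res_act g (res_act h v).
Proof. by rewrite /res_act rmorphM actM. Qed.
Lemma res_act_mul h v w :
  res_act h (v * w) = tlift (fun x y => res_act x v * res_act y w) (comul hL h).
Proof.
have [al ar] := act_bilin aV.
have b : bilin (fun x y => act aV x v * act aV y w).
  split=> [y c x x'|x c y y'] /=; first by rewrite al mulrDl scalerAl.
  by rewrite al mulrDr scalerAr.
rewrite /res_act act_mul (morph_comul hi) tlift_tlift //.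
by apply: eq_tlift => x y; rewrite tliftE.
Qed.
Lemma res_act_one h : res_act h 1 = (counit hL h)%:A.
Proof. by rewrite /res_act act_one (morph_counit hi). Qed.

Definition restriction : module_algebra hL V :=
  ModuleAlgebra res_act_bilin res_act1 res_actM res_act_mul res_act_one.

End Restriction.

(* V # L: the space V (x) L, with a product that depends on the action. *)
Definition smash_product (k : fieldType) (L V : algType k) (hL : hopf_algebra L)
  (aV : module_algebra hL V) : Type := (V ⊗ L)%type.

Section Smash.
Variables (k : fieldType) (L V : algType k) (hL : hopf_algebra L).
Variable aV : module_algebra hL V.

Local Notation smash := (smash_product aV).
HB.instance Definition _ := GRing.Lmodule.on smash.

Definition smash_mul (x y : smash) : smash :=
  tlift (fun v l => tlift (fun w l' =>
    tlift (fun l1 l2 => (v * act aV l1 w) ⊗ (l2 * l')) (comul hL l)) y) x.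

Lemma smash_bilin1 (v w : V) (l' : L) :
  bilin (fun l1 l2 => (v * act aV l1 w) ⊗ (l2 * l')).
Proof.
have [al ar] := act_bilin aV.
split=> [l2 c x x'|l1 c x x'] /=.
  by rewrite al mulrDr -scalerAr tensDl tensZl.
by rewrite mulrDl -scalerAl tensDr tensZr.
Qed.

Lemma smash_bilin2 (v : V) (l : L) :
  bilin (fun w l' => tlift (fun l1 l2 => (v * act aV l1 w) ⊗ (l2 * l')) (comul hL l)).
Proof.
have [al ar] := act_bilin aV.
split=> [l'|w]; apply: tlift_linear_param => l1 l2 c x x'.
  by rewrite ar mulrDr -scalerAr tensDl tensZl.
by rewrite mulrDr -scalerAr tensDr tensZr.
Qed.

Lemma smash_bilin3 (y : smash) :
  bilin (fun v l => tlift (fun w l' =>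
    tlift (fun l1 l2 => (v * act aV l1 w) ⊗ (l2 * l')) (comul hL l)) y).
Proof.
split=> [l|v]; apply: tlift_linear_param => w l'.
  apply: tlift_linear_param => l1 l2 c x x'.
  by rewrite mulrDl -scalerAl tensDl tensZl.
move=> c x x'; rewrite linearP.
exact/tlift_linear/smash_bilin1.
Qed.

Lemma smash_mulE (v w : V) (l l' : L) :
  smash_mul (v ⊗ l) (w ⊗ l') =
  tlift (fun l1 l2 => (v * act aV l1 w) ⊗ (l2 * l')) (comul hL l).
Proof.
by rewrite /smash_mul tliftE ?tliftE //; [exact: smash_bilin2|exact: smash_bilin3].
Qed.

Lemma smash_linl y : linear (smash_mul^~ y).
Proof. exact/tlift_linear/smash_bilin3. Qed.

Lemma smash_linr x : linear (smash_mul x).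
Proof. by apply: tlift_linear_param => v l; exact/tlift_linear/smash_bilin2. Qed.

Lemma smash_mulDl : left_distributive smash_mul +%R.
Proof. by move=> x y z; have := smash_linl z 1 x y; rewrite !scale1r. Qed.
Lemma smash_mulDr : right_distributive smash_mul +%R.
Proof. by move=> x y z; have := smash_linr x 1 y z; rewrite !scale1r. Qed.

Lemma smash_tliftl (f : L -> L -> smash) (h : L ⊗ L) (y : smash) :
  smash_mul (tlift f h) y = tlift (fun a b => smash_mul (f a b) y) h.
Proof.
pose hl := GRing.isLinear.Build k smash smash _ (smash_mul^~ y) (smash_linl y).
pose F : {linear smash -> smash} := HB.pack (smash_mul^~ y) hl.
exact: (tlift_comp F).
Qed.

Lemma smash_tliftr (f : L -> L -> smash) (h : L ⊗ L) (x : smash) :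
  smash_mul x (tlift f h) = tlift (fun a b => smash_mul x (f a b)) h.
Proof.
pose hl := GRing.isLinear.Build k smash smash _ (smash_mul x) (smash_linr x).
pose F : {linear smash -> smash} := HB.pack (smash_mul x) hl.
exact: (tlift_comp F).
Qed.

Lemma smash_mul_pureA (v w u : V) (l m n : L) :
  smash_mul (v ⊗ l) (smash_mul (w ⊗ m) (u ⊗ n)) =
  smash_mul (smash_mul (v ⊗ l) (w ⊗ m)) (u ⊗ n).
Proof.
have [al ar] := act_bilin aV.
rewrite (smash_mulE w) (smash_mulE v).
rewrite smash_tliftr smash_tliftl.
under eq_tlift do rewrite smash_mulE.
under [RHS]eq_tlift do
  rewrite smash_mulE rmorphM (tlift_mul _ _ (smash_bilin1 _ _ _)) exchange_tlift.
rewrite [RHS]exchange_tlift; apply: eq_tlift => m1 m2.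
pose F a b c : smash := (v * (act aV a w * act aV (b * m1) u)) ⊗ (c * m2 * n).
transitivity (tlift (fun x y => tlift (fun a b => F a b y) (comul hL x)) (comul hL l)).
  apply: eq_tlift => l1 l2; rewrite act_mul.
  pose g z : V ⊗ L := (v * z) ⊗ (l2 * (m2 * n)).
  have gl : linear g by move=> c x y; rewrite /g mulrDr -scalerAr tensDl tensZl.
  pose hl := GRing.isLinear.Build k V _ _ g gl.
  pose G : {linear V -> (V ⊗ L)%type} := HB.pack g hl.
  transitivity (G (tlift (fun a b => act aV a w * act aV b (act aV m1 u)) (comul hL l1))).
    by [].
  rewrite tlift_comp; apply: eq_tlift => a b.
  by rewrite /= /g /F actM (mulrA l2).
rewrite tlift_coassoc /F.
- apply: eq_tlift => x y; apply: eq_tlift => a b.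
  by rewrite !mulrA.
- by move=> b c e x y; rewrite al mulrDl -scalerAl mulrDr -scalerAr tensDl tensZl.
- move=> b c e x y.
  by rewrite mulrDl -scalerAl al !(mulrDr, =^~ scalerAr) tensDl tensZl.
- move=> a b e x y.
  by rewrite mulrDl -scalerAl mulrDl -scalerAl tensDr tensZr.
Qed.

Lemma smash_mulA : associative smash_mul.
Proof.
move=> x y z; elim/tens_ind: x => [v l|x x' Hx Hx']; last by rewrite !smash_mulDl Hx Hx'.
elim/tens_ind: y => [w m|y y' Hy Hy'].
  elim/tens_ind: z => [u n|z z' Hz Hz']; first exact: smash_mul_pureA.
  by rewrite !smash_mulDr Hz Hz'.
by rewrite smash_mulDl !smash_mulDr smash_mulDl Hy Hy'.
Qed.

Lemma smash_mul1 : left_id (1 ⊗ 1) smash_mul.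
Proof.
elim/tens_ind => [w l|x x' Hx Hx']; last by rewrite smash_mulDr Hx Hx'.
rewrite smash_mulE rmorph1 tliftE; last exact: smash_bilin1.
by rewrite act1 !mul1r.
Qed.

Lemma smash_mulr1 : right_id (1 ⊗ 1) smash_mul.
Proof.
elim/tens_ind => [v l|x x' Hx Hx']; last by rewrite smash_mulDl Hx Hx'.
rewrite smash_mulE -{2}[l](counit_l hL).
pose g z : V ⊗ L := v ⊗ z.
have gl : linear g by move=> c x y; rewrite /g tensDr tensZr.
pose hl := GRing.isLinear.Build k L _ _ g gl.
pose G : {linear L -> (V ⊗ L)%type} := HB.pack g hl.
transitivity (G (tlift (fun x y => counit hL x *: y) (comul hL l))); last by [].
rewrite tlift_comp; apply: eq_tlift => l1 l2.
by rewrite act_one mulr1 -scalerAr mulr1 tensZl; exact/esym/tensZr.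
Qed.

HB.instance Definition _ := GRing.Zmodule_isNzRing.Build smash
  smash_mulA smash_mul1 smash_mulr1 smash_mulDl smash_mulDr (@tone_neq0 k V L).

Lemma smash_scaleAl (c : k) (x y : smash) :
  c *: smash_mul x y = smash_mul (c *: x) y.
Proof.
by have := smash_linl y c x 0; rewrite (mul0r y : smash_mul 0 y = 0) !addr0 => ->.
Qed.
Lemma smash_scaleAr (c : k) (x y : smash) :
  c *: smash_mul x y = smash_mul x (c *: y).
Proof.
by have := smash_linr x c y 0; rewrite (mulr0 x : smash_mul x 0 = 0) !addr0 => ->.
Qed.

HB.instance Definition _ := GRing.Lmodule_isLalgebra.Build k smash smash_scaleAl.
HB.instance Definition _ := GRing.Lalgebra_isAlgebra.Build k smash smash_scaleAr.

End Smash.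

(* Tensor product over B of a right B-module M and a left B-module N, with    *)
(* right action [rho b m = m b] and left action [lam b n = b n].              *)
Section BalancedTensor.
Variables (k : fieldType) (B : Type) (M N : lmodType k).
Variables (rho : B -> M -> M) (lam : B -> N -> N).

Definition bal_rel (x : (M ⊗ N)%type) : Prop :=
  exists b m n, x = rho b m ⊗ n - m ⊗ lam b n.

Definition btens := quotmod bal_rel.
HB.instance Definition _ := GRing.Lmodule.on btens.

Definition bproj (x : (M ⊗ N)%type) : btens := qproj bal_rel x.

Definition btensor (m : M) (n : N) : btens := bproj (m ⊗ n).

(* The map on the quotient induced by [f]; meaningful when [f] is bilinear    *)
(* and balanced: f (m b) n = f m (b n).                                       *)
Definition blift (X : lmodType k) (f : M -> N -> X) (x : btens) : X :=
  tlift f (repr x).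

Lemma bliftE (X : lmodType k) (f : M -> N -> X) m n :
  bilin f -> (forall b m n, f (rho b m) n = f m (lam b n)) ->
  blift f (btensor m n) = f m n.
Proof.
move=> fb fbal; rewrite /blift /btensor /bproj.
pose h := GRing.isLinear.Build k _ X _ (tlift f) (tlift_linear fb).
pose F : {linear (M ⊗ N)%type -> X} := HB.pack (tlift f) h.
rewrite (_ : tlift f _ = F (repr (qproj bal_rel (m ⊗ n)))) // quot_lift.
  exact: tliftE.
move=> _ [b [m' [n' ->]]]; rewrite linearB /= !tliftE //.
by rewrite fbal subrr.
Qed.

End BalancedTensor.

Section BialgebroidSpaces.
Variables (k : fieldType) (B T : algType k) (alpha beta : B -> T).

Definition left_act (b : B) (t : T) : T := alpha b * t.
Definition right_act (b : B) (t : T) : T := beta b * t.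

(* T (x)_B T *)
Definition TT := btens right_act left_act.
HB.instance Definition _ := GRing.Lmodule.on TT.
Definition TT_tensor (t t' : T) : TT := btensor right_act left_act t t'.
Definition TT_left (b : B) : TT -> TT :=
  blift (fun t t' => TT_tensor (left_act b t) t').
Definition TT_right (b : B) : TT -> TT :=
  blift (fun t t' => TT_tensor t (right_act b t')).

(* (T (x)_B T) (x)_B T and T (x)_B (T (x)_B T) *)
Definition TTT := btens TT_right left_act.
HB.instance Definition _ := GRing.Lmodule.on TTT.
Definition TTT' := btens right_act TT_left.
HB.instance Definition _ := GRing.Lmodule.on TTT'.

Definition TT_assoc : TTT' -> TTT :=
  blift (fun t => blift (fun t' t'' =>
    btensor TT_right left_act (TT_tensor t t') t'')).

(* right multiplication of T (x) T on T (x)_B T *)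
Definition TT_rmul (x : TT) (y : (T ⊗ T)%type) : TT :=
  blift (fun t t' => tlift (fun s s' => TT_tensor (t * s) (t' * s')) y) x.

(* The map phi, whose domain is regarded as T (x) T^op (x) T^op. *)
Definition phi (Delta : T -> TT) : (T ⊗ T^c ⊗ T^c)%type -> TT :=
  tlift (fun (x : (T ⊗ T^c)%type) (t'' : T^c) =>
    tlift (fun (t : T) (t' : T^c) => TT_rmul (Delta t) ((t' : T) ⊗ (t'' : T))) x).

End BialgebroidSpaces.

Definition left_ideal (k : fieldType) (A : algType k) (I : A -> Prop) : Prop :=
  [/\ I 0, forall x y, I x -> I y -> I (x + y) & forall a x, I x -> I (a * x)].

Record bialgebroid (k : fieldType) (B T : algType k) := Bialgebroid {
  source : {lrmorphism B -> T};
  target : {linear B -> T};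
  target1 : target 1 = 1;
  targetM : forall b b', target (b * b') = target b' * target b;
  source_target : forall b b', source b * target b' = target b' * source b;
  bcomul : {linear T -> TT source target};
  bcomul_left : forall b t, bcomul (source b * t) = TT_left b (bcomul t);
  bcomul_right : forall b t, bcomul (target b * t) = TT_right b (bcomul t);
  bcomul1 : bcomul 1 = TT_tensor source target 1 1;
  bcomulA : forall t,
    blift (fun x y => btensor _ _ (bcomul x) y : TTT source target) (bcomul t) =
    TT_assoc (blift (fun x y => btensor _ _ x (bcomul y) : TTT' source target)
                    (bcomul t));
  bcomul_ker : left_ideal (fun x => phi bcomul x = 0);
  bcounit : {linear T -> B};
  bcounit_left : forall b t, bcounit (source b * t) = b * bcounit t;
  bcounit_right : forall b t, bcounit (target b * t) = bcounit t * b;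
  bcounit1 : bcounit 1 = 1;
  bcounitl : forall t, blift (fun x y => source (bcounit x) * y) (bcomul t) = t;
  bcounitr : forall t, blift (fun x y => target (bcounit y) * x) (bcomul t) = t;
  bcounit_ker : left_ideal (fun x => bcounit x = 0)
}.

Record hopf_algebroid (k : fieldType) (B T : algType k) := HopfAlgebroid {
  hb_bialgebroid :> bialgebroid B T;
  antipode : {linear T -> T};
  antipode1 : antipode 1 = 1;
  antipodeM : forall x y, antipode (x * y) = antipode y * antipode x;
  antipode_bij : bijective antipode;
  antipode_target : forall b,
    antipode (target hb_bialgebroid b) = source hb_bialgebroid b;
  antipode_left : forall t,
    blift (fun x y => antipode x * y) (bcomul hb_bialgebroid t) =
    target hb_bialgebroid (bcounit hb_bialgebroid (antipode t));
  antipode_right :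
    exists2 gamma : {linear TT (source hb_bialgebroid) (target hb_bialgebroid)
                       -> (T ⊗ T)%type},
      (forall x, bproj _ _ (gamma x) = x) &
      (forall t, tlift (fun x y => x * antipode y) (gamma (bcomul hb_bialgebroid t)) =
         source hb_bialgebroid (bcounit hb_bialgebroid t))
}.

(* Main.v *)
Require Import Defs.
From HB Require Import structures.
From mathcomp Require Import all_boot all_algebra.
From mathcomp Require Import boolp.

Set Implicit Arguments.
Unset Strict Implicit.
Unset Printing Implicit Defensive.

Import GRing.Theory.
Local Open Scope ring_scope.

(** Write [R = \sum_j a j ⊗ b j] with as few summands as possible. Then the [a j]
    are independent and span the left leg [L] of [R], because the [b j] are
    independent as well ([tens_dual]). The hexagon identities, read through the
    functionals dual to the [b j], show that [L] is a subalgebra and a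
    subcoalgebra. For the antipode one uses [R = (S ⊗ S) R]: it expresses each
    [a j] through the [S (a l)] by a square matrix, which is therefore
    invertible, and [S] maps [L] bijectively onto itself. The projection of [H]
    onto [L] given by the functionals dual to the [a j] turns the identities for
    [R] in powers of [H] into identities with the left leg taken in [L]
    ([left_R_matrix]); all the rest follows from these.

    In [T = V # L] put [α v = v # 1], [ι l = 1 # l] (so [v # l = α v * ι l]) and
    [β v = \sum_j (b j v) # (a j)]. The source map is [α] and the target map is
    [β]. That [β] is an anti-homomorphism whose image commutes with that of [α]
    combines the hexagon identities with quantum commutativity. The relation
    [Δ^cop R = R Δ] becomes [ι l * β v = \sum β (l2 v) * ι l1] ([smL_target]),
    the mirror image of the defining relation [ι l * α v = \sum α (l1 v) * ι l2].

    The coproduct is [v # l |-> (v # l1) ⊗ ι l2]. It has an obvious lift to the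
    tensor product of [T] with itself over [k], and this lift is an algebra map.
    The relation [smL_target] says precisely that left multiplication by an
    element of the image of the lift is well defined on the tensor product
    over [V] ([sm_cop_bal]). Hence the coproduct is multiplicative in the only
    sense available, the map [phi] intertwines left multiplications, and its
    kernel is a left ideal ([lift_comul_ker]). The counit [v # l |-> ε(l) v] is
    the value at [1] of the action of [T] on [V], so its kernel is a left ideal.

    Since [R] is invertible with inverse [(S ⊗ id) R], the elements [β v * ι l]
    represent [T] as well as the elements [α v * ι l] do, and the antipode is
    given by [β v * ι l |-> ι (S l) * α v]. It is bijective because [S] is
    bijective on [L], and anti-multiplicative by the two exchange relations. The
    left antipode axiom reduces to the fact that the antipode sends [α v] into
    the image of [β] ([sm_antip_smV_target]). For the right antipode axiom the
    section [gamma] comes from the isomorphism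
    [t ⊗ (v # l) |-> β v * t ⊗ l] of the tensor square of [T] over [V] with
    [T ⊗ L] over [k]. *)

(** * Linearity of multilinear expressions *)

(** Fixes the module structures of source and target. Elaborating [linear f] may
    choose different paths to the underlying semimodules, and comparing these
    paths is expensive on iterated quotients. *)
Definition linmap (k : fieldType) (U V : lmodType k) (f : U -> V) : Prop := linear f.

Section LinearBasics.
Variable k : fieldType.
Implicit Types U V W X Y M N : lmodType k.

Lemma linear_compose U V W (g : V -> W) (f : U -> V) :
  linear g -> linear f -> linear (fun x => g (f x)).
Proof. by move=> lg lf a x y; rewrite lf lg. Qed.

Lemma linear_sumf U V I (r : seq I) (f : I -> U -> V) :
  (forall i, linear (f i)) -> linear (fun x => \sum_(i <- r) f i x).
Proof.
move=> lf a x y; rewrite scaler_sumr -big_split /=.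
by apply: eq_bigr => i _; exact: lf.
Qed.

Lemma linear_tensorl U V v : linear (fun u : U => (u ⊗ v : (U ⊗ V)%type)).
Proof. exact: (tensor_bilin U V).1. Qed.

Lemma linear_tensorr U V u : linear (tensor u : V -> (U ⊗ V)%type).
Proof. exact: (tensor_bilin U V).2. Qed.

Lemma linear_mull (A : algType k) (b : A) : linear (fun a : A => a * b).
Proof. by move=> c x y; rewrite mulrDl scalerAl. Qed.

Lemma linear_mulr (A : algType k) (a : A) : linear (GRing.mul a).
Proof. by move=> c x y; rewrite mulrDr scalerAr. Qed.

Lemma linear_scalel U V (f : U -> k^o) (v : V) :
  linear f -> linear (fun x => (f x : k) *: v).
Proof. by move=> lf c x y; rewrite lf scalerDl scalerA. Qed.

Lemma linear_scaler U c : linear (GRing.scale c : U -> U).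
Proof. by move=> a x y; rewrite scalerDr !scalerA mulrC. Qed.

Lemma linear_actl (H : algType k) (hH : hopf_algebra H) (V : algType k)
  (aV : module_algebra hH V) v : linear (fun h => act aV h v).
Proof. exact: (act_bilin aV).1. Qed.

Lemma linear_actr (H : algType k) (hH : hopf_algebra H) (V : algType k)
  (aV : module_algebra hH V) h : linear (act aV h).
Proof. exact: (act_bilin aV).2. Qed.

Lemma linear_tlift_arg U V W X (f : U -> V -> X) (g : W -> (U ⊗ V)%type) :
  bilin f -> linear g -> linear (fun w => tlift f (g w)).
Proof. by move=> bf lg a x y; rewrite lg; exact: tlift_linear. Qed.

Lemma linear_tlift_fun U V X Y (F : Y -> U -> V -> X) x :
  (forall u v, linear (fun y => F y u v)) -> linear (fun y => tlift (F y) x).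
Proof. exact: tlift_linear_param. Qed.

Lemma bproj_linear (B : Type) M N (rho : B -> M -> M) (lam : B -> N -> N) :
  linear (bproj rho lam).
Proof. exact: linearP. Qed.

(** Lets a map that is only known to be linear be used as a [{linear U -> V}]. *)
Definition linpack U V (f : U -> V) (lf : linear f) : {linear U -> V} :=
  HB.pack f (GRing.isLinear.Build k U V _ f lf).

Lemma linear0_at U V (f : U -> V) : linear f -> f 0 = 0.
Proof. by move=> lf; exact: (linear0 (linpack lf)). Qed.

Lemma linearD_at U V (f : U -> V) x y : linear f -> f (x + y) = f x + f y.
Proof. by move=> lf; exact: (linearD (linpack lf)). Qed.

Lemma linearZ_at U V (f : U -> V) a x : linear f -> f (a *: x) = a *: f x.
Proof. by move=> lf; exact: (linearZ_LR (linpack lf)). Qed.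

Lemma linear_sum_at U V (f : U -> V) I (r : seq I) (F : I -> U) : linear f ->
  f (\sum_(i <- r) F i) = \sum_(i <- r) f (F i).
Proof. by move=> lf; exact: (linear_sum (linpack lf)). Qed.

Lemma linear_tlift U V X Y (h : X -> Y) (f : U -> V -> X) x : linear h ->
  h (tlift f x) = tlift (fun u v => h (f u v)) x.
Proof. by move=> lh; exact: (tlift_comp (linpack lh)). Qed.

End LinearBasics.

(** The base cases of [lin]: maps linear in one argument, known from a hypothesis,
    from a library of constants, or from the extensible [lin_more]. *)
Ltac lin_hyp :=
  match goal with
  | h : bilin _ |- _ => first [exact (proj1 h _) | exact (proj2 h _)]
  | h : linmap _ |- _ => exact h
  | h : forall _, linmap _ |- _ => exact (h _)
  | h : GRing.linear_for _ _ |- _ => exact h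
  | h : forall _, GRing.linear_for _ _ |- _ => exact (h _)
  | h : forall _ _, GRing.linear_for _ _ |- _ => exact (h _ _)
  end.
Ltac lin_more := fail.
Ltac lin_base :=
  cbn beta;
  lazymatch goal with
  | |- GRing.linear_for _ (fun x => x) => exact (fun _ _ _ => erefl)
  | |- GRing.linear_for _ (fun x => tensor x _) => exact: linear_tensorl
  | |- GRing.linear_for _ (tensor _) => exact: linear_tensorr
  | |- GRing.linear_for _ (fun x => GRing.mul x _) => exact: linear_mull
  | |- GRing.linear_for _ (GRing.mul _) => exact: linear_mulr
  | |- GRing.linear_for _ (fun x => act _ x _) => exact: linear_actl
  | |- GRing.linear_for _ (act _ _) => exact: linear_actr
  | |- GRing.linear_for _ (GRing.scale _) => exact: linear_scaler
  | |- GRing.linear_for _ (bproj _ _) => exact: bproj_linear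
  | |- GRing.linear_for _ (GRing.Linear.sort _) => exact: linearP
  | |- GRing.linear_for _ (fun x => GRing.Linear.sort _ x) => exact: linearP
  | |- GRing.linear_for _ (GRing.LRMorphism.sort _) => exact: linearP
  | |- GRing.linear_for _ (fun x => GRing.LRMorphism.sort _ x) => exact: linearP
  | |- _ => first [lin_more | lin_hyp]
  end.

(** Linearity of nested expressions: peels off one map at a time along the path
    that leads to the variable. *)
Ltac lin :=
  intros; cbn beta;
  lazymatch goal with
  | |- bilin _ => split; lin
  | |- linmap ?f => red; lin
  | |- GRing.linear_for _ _ =>
    first
    [ lin_base
    | match goal with
      | |- GRing.linear_for _ (fun x => bigop _ _ _) => apply: linear_sumf; lin
      | |- GRing.linear_for _ (tlift _) => apply: tlift_linear; lin
      | |- GRing.linear_for _ (fun x => tlift ?F (@?g x)) =>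
          apply: (@linear_tlift_arg _ _ _ _ _ F g); lin
      | |- GRing.linear_for _ (fun x => tlift (@?F x) ?z) =>
          apply: (@linear_tlift_fun _ _ _ _ _ F z); lin
      | |- GRing.linear_for _ (fun x => GRing.scale (@?f x) ?v) =>
          apply: (@linear_scalel _ _ _ f v); lin
      | |- GRing.linear_for _ (fun x => ?h (@?f x)) =>
          apply: (@linear_compose _ _ _ _ h f); [lin_base | lin]
      | |- GRing.linear_for _ (fun x => ?h (@?f x) ?y) =>
          apply: (@linear_compose _ _ _ _ (fun u => h u y) f); [lin_base | lin]
      | |- GRing.linear_for _ (fun x => ?h (@?f x) ?y ?z) =>
          apply: (@linear_compose _ _ _ _ (fun u => h u y z) f); [lin_base | lin]
      end ]
  end.

(** * Tensors as finite sums *)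

Section FiniteSums.
Variable k : fieldType.
Implicit Types U V W X : lmodType k.

Definition scalarpack U (f : U -> k) (lf : scalar f) : {scalar U} :=
  HB.pack f (GRing.isLinear.Build k U k _ f lf).

Lemma tlift_sumE U V X (f : U -> V -> X) I (r : seq I) (a : I -> U) (b : I -> V) :
  bilin f -> tlift f (\sum_(i <- r) a i ⊗ b i) = \sum_(i <- r) f (a i) (b i).
Proof.
move=> bf; rewrite (linear_sum_at _ _ (tlift_linear bf)).
by apply: eq_bigr => i _; rewrite tliftE.
Qed.

Lemma tens_sum U V (x : (U ⊗ V)%type) : exists n (a : 'I_n -> U) (b : 'I_n -> V),
  x = \sum_i a i ⊗ b i.
Proof.
elim/tens_ind: x => [u v|x y [m [a [b ->]]] [n [c [d ->]]]].
  by exists 1%N, (fun=> u), (fun=> v); rewrite big_ord1.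
exists (m + n)%N, (fun i => match split i with inl j => a j | inr j => c j end),
  (fun i => match split i with inl j => b j | inr j => d j end).
rewrite big_split_ord; congr (_ + _); apply: eq_bigr => i _.
  by rewrite -[lshift _ _]/(unsplit (inl i)) unsplitK.
by rewrite -[rshift _ _]/(unsplit (inr i)) unsplitK.
Qed.

(** The other vectors are killed by passing to the quotient by their span, where
    the image of [a j] is nonzero. *)
Lemma separating_functional U n (a : 'I_n -> U) j :
  (forall c : 'I_n -> k, a j != \sum_(i | i != j) c i *: a i) ->
  exists f : {linear U -> k^o}, forall i, f (a i) = (i == j)%:R.
Proof.
move=> indep; pose P x := exists2 i, i != j & x = a i.
have [f f1] : exists f : {scalar quotmod P}, f (qproj P (a j)) = 1.
  apply: functional_ex; apply/eqP => aj0.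
  have /asboolP[s [sP aj]] : a j \in lspan P.
    have rP x : repr (qproj P x) - x \in lspan P := repr_pi_span P x.
    have := rpredB (rP 0) (rP (a j)).
    by rewrite aj0 linear0 subr0 opprB addrC subrK.
  suff [c E] : exists c : 'I_n -> k,
      \sum_(p <- s) p.1 *: p.2 = \sum_(i | i != j) c i *: a i.
    by have := indep c; rewrite {1}aj E eqxx.
  elim: s sP {aj} => [|[d u] s IH] sP.
    by exists (fun=> 0); rewrite big_nil big1 // => i _; rewrite scale0r.
  have [|c E] := IH; first by move=> p ps; apply: sP; rewrite inE ps orbT.
  have [i0 ij /= ->] := sP _ (mem_head _ _).
  exists (fun i => (i == i0)%:R * d + c i).
  rewrite big_cons E /=; under [RHS]eq_bigr do rewrite scalerDl.
  rewrite big_split; congr (_ + _).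
  rewrite (bigD1 i0) //= eqxx mul1r big1 ?addr0 // => i /andP[_ /negPf->].
  by rewrite mul0r scale0r.
have lf : linear (fun x => f (qproj P x) : k^o) by move=> c x y; rewrite !linearP.
exists (linpack lf) => i /=; have [->//|ij] := eqVneq.
by rewrite qproj_gen ?linear0 //; exists i.
Qed.

(** A shortest expression of a tensor as a sum of pure tensors has linearly
    independent factors on both sides: a dependency would allow one
    summand to be absorbed into the others. Independence is recorded by dual functionals. *)
Lemma tens_dual U V (x : (U ⊗ V)%type) :
  exists n (a : 'I_n -> U) (b : 'I_n -> V)
    (q : 'I_n -> {linear U -> k^o}) (p : 'I_n -> {linear V -> k^o}),
  [/\ x = \sum_i a i ⊗ b i, forall i j, q j (a i) = (i == j)%:R &
      forall i j, p j (b i) = (i == j)%:R].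
Proof.
pose len n := `[< exists (a : 'I_n -> U) (b : 'I_n -> V), x = \sum_i a i ⊗ b i >].
have ex : exists n, len n by have [n xE] := tens_sum x; exists n; apply/asboolP.
case: (ex_minnP ex) => n /asboolP[a [b xE]] nmin.
have drop (c : 'I_n -> k) j : a j = \sum_(i | i != j) c i *: a i \/
    b j = \sum_(i | i != j) c i *: b i -> False.
  case: n a b xE nmin c j => [|n] a b xE nmin c j dep; first by case: j {dep}.
  suff /nmin : len n by rewrite ltnn.
  apply/asboolP; move: xE; rewrite (bigD1_ord j) //=.
  have Eb (W : lmodType k) (w : 'I_n.+1 -> W) :
    \sum_(i | i != j) c i *: w i = \sum_(i < n) c (lift j i) *: w (lift j i).
    by rewrite big_mkcond (bigD1_ord j) //= eqxx add0r;
       apply: eq_bigr => i _; rewrite eq_sym neq_lift.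
  case: dep => ->; rewrite Eb => ->.
    exists (fun i => a (lift j i)),
      (fun i => c (lift j i) *: b j + b (lift j i)).
    rewrite (linear_sum_at _ _ (@linear_tensorl _ U V (b j))) -big_split.
    by apply: eq_bigr => i _; rewrite /= tensDr tensZl tensZr.
  exists (fun i => c (lift j i) *: a j + a (lift j i)), (fun i => b (lift j i)).
  rewrite (linear_sum_at _ _ (@linear_tensorr _ U V (a j))) -big_split.
  by apply: eq_bigr => i _; rewrite /= tensDl tensZl tensZr.
have /(_ _)/cid qE j : exists f : {linear U -> k^o}, forall i, f (a i) = (i == j)%:R.
  apply: separating_functional => c; apply/eqP => E.
  by apply: (drop c j); left.
have /(_ _)/cid pE j : exists f : {linear V -> k^o}, forall i, f (b i) = (i == j)%:R.
  apply: separating_functional => c; apply/eqP => E.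
  by apply: (drop c j); right.
exists n, a, b, (fun j => sval (qE j)), (fun j => sval (pE j)).
by split=> // i j; [case: (qE j)|case: (pE j)].
Qed.

End FiniteSums.

(** * Balanced tensor products *)

Section Balanced.
Variables (k : fieldType) (B : Type) (M N : lmodType k).
Variables (rho : B -> M -> M) (lam : B -> N -> N).

Lemma bproj_surj (x : btens rho lam) : exists z, x = bproj rho lam z.
Proof. by exists (repr x); rewrite /bproj qprojK. Qed.

Lemma bproj_bal b m n :
  btensor rho lam (rho b m) n = btensor rho lam m (lam b n).
Proof.
apply/eqP; rewrite -subr_eq0 /btensor /bproj -linearB; apply/eqP.
by apply: qproj_gen; exists b, m, n.
Qed.

Lemma btens_ind (Q : btens rho lam -> Prop) :
  (forall m n, Q (btensor rho lam m n)) ->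
  (forall x y, Q x -> Q y -> Q (x + y)) -> forall x, Q x.
Proof.
move=> Qt QD x; have [z ->] := bproj_surj x.
elim/tens_ind: z => [m n|y z Qy Qz]; first exact: Qt.
by rewrite (linearD_at _ _ (bproj_linear rho lam)); exact: QD.
Qed.

Definition balanced (X : Type) (f : M -> N -> X) :=
  forall b m n, f (rho b m) n = f m (lam b n).

Section BLift.
Variables (X : lmodType k) (f : M -> N -> X).
Hypotheses (bf : bilin f) (balf : balanced f).

Lemma blift_bproj z : blift f (bproj rho lam z) = tlift f z.
Proof.
pose F := linpack (tlift_linear bf).
rewrite /blift /bproj; apply: (quot_lift (F := F)) => _ [b [m [n ->]]].
by rewrite (linearB F) /= !tliftE // balf subrr.
Qed.

Lemma linear_blift : linear (blift f : btens rho lam -> X).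
Proof.
move=> a x y; have [[z ->] [w ->]] := (bproj_surj x, bproj_surj y).
by rewrite -(bproj_linear rho lam a) !blift_bproj; exact: tlift_linear.
Qed.

End BLift.

Lemma linear_btensorl n : linear (fun m => btensor rho lam m n).
Proof. by move=> a x y; rewrite /btensor tensDl tensZl; exact: bproj_linear. Qed.

Lemma linear_btensorr m : linear (btensor rho lam m).
Proof. by move=> a x y; rewrite /btensor tensDr tensZr; exact: bproj_linear. Qed.

End Balanced.

(** * Hopf algebras *)

Section Hopf.
Variables (k : fieldType) (H : algType k) (hH : hopf_algebra H).
Local Notation Δ := (comul hH).
Local Notation ε := (counit hH).
Local Notation S := (antip hH).

Section Applied.
Variables (X : lmodType k) (G : H -> X).
Hypothesis lG : linear G.

Lemma counit_l_lin h : tlift (fun x y => (ε x : k) *: G y) (Δ h) = G h.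
Proof.
rewrite -{2}[h](counit_l hH) (linear_tlift _ _ lG).
by apply: eq_tlift => x y; rewrite (linearZ_at _ _ lG).
Qed.

Lemma counit_r_lin h : tlift (fun x y => (ε y : k) *: G x) (Δ h) = G h.
Proof.
rewrite -{2}[h](counit_r hH) (linear_tlift _ _ lG).
by apply: eq_tlift => x y; rewrite (linearZ_at _ _ lG).
Qed.

Lemma antip_l_lin h : tlift (fun x y => G (S x * y)) (Δ h) = (ε h : k) *: G 1.
Proof.
by rewrite -(linear_tlift (fun x y => S x * y) _ lG) antip_l (linearZ_at _ _ lG).
Qed.

Lemma antip_r_lin h : tlift (fun x y => G (x * S y)) (Δ h) = (ε h : k) *: G 1.
Proof.
by rewrite -(linear_tlift (fun x y => x * S y) _ lG) antip_r (linearZ_at _ _ lG).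
Qed.

End Applied.

Lemma antip1 : S 1 = 1.
Proof.
have := antip_l hH 1; rewrite rmorph1 tliftE; last by lin.
by rewrite mulr1 rmorph1 scale1r.
Qed.

(** [S (g * h)] and [S h * S g] are a left and a right convolution inverse of
    the product. *)
Lemma antipM g h : S (g * h) = S h * S g.
Proof.
(* The antipode axiom collapses E to S (g * h) on the right, where b * e meets
   S f * S c, and to S h * S g on the left, where S (a * d) meets b * e. *)
pose E a b c d e f := S (a * d) * b * e * S f * S c.
have l a : linear (fun d => S (a * d)).
  exact: (linear_compose (linearP S) (@linear_mulr _ H a)).
have r d : linear (fun a => S (a * d)).
  exact: (linear_compose (linearP S) (@linear_mull _ H d)).
transitivity (tlift (fun a c => tlift (fun a b =>
    tlift (fun d f => tlift (fun d e => E a b c d e f) (Δ d)) (Δ h))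
    (Δ a)) (Δ g)).
  transitivity (tlift (fun a c => tlift (fun a b => S (a * h) * b * S c) (Δ a)) (Δ g)).
    rewrite tlift_coassoc; [|lin..].
    rewrite -(counit_r_lin (r h)); apply: eq_tlift => a c.
    have -> : tlift (fun b c => S (a * h) * b * S c) (Δ c)
            = tlift (fun b c => S (a * h) * (b * S c)) (Δ c).
      by apply: eq_tlift => x y; rewrite mulrA.
    by rewrite (antip_r_lin (@linear_mulr _ H (S (a * h)))) mulr1.
  apply: eq_tlift => x c; apply: eq_tlift => a b; rewrite /E.
  rewrite tlift_coassoc; [|lin..].
  have lG : linear (fun d => S (a * d) * b * S c) by lin.
  rewrite -(counit_r_lin lG); apply: eq_tlift => d f.
  have lG' : linear (fun z => S (a * d) * b * z * S c) by lin.
  transitivity (tlift (fun p q => S (a * d) * b * (p * S q) * S c) (Δ f)).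
    by rewrite (antip_r_lin lG') mulr1.
  by apply: eq_tlift => p q; rewrite !mulrA.
rewrite -(counit_l_lin (linearP S) g) (linear_tlift _ _ (@linear_mulr _ H (S h))).
apply: eq_tlift => x c; rewrite exchange_tlift.
rewrite -scalerAr -(counit_l_lin (linearP S) h) (linear_tlift _ _ (@linear_mull _ H (S c))).
rewrite (linear_tlift _ _ (@linear_scaler _ H _)); apply: eq_tlift => y f.
rewrite -scalerAl scalerA -[(_ * _ : k)]/(ε x * ε y : k^o) -rmorphM.
have lG : linear (fun z : H => z * (S f * S c)) by lin.
have := antip_l_lin lG (x * y); rewrite mul1r => <-.
rewrite rmorphM tlift_mul; last by lin.
by apply: eq_tlift => a b; apply: eq_tlift => d e; rewrite /E !mulrA.
Qed.

End Hopf.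

(** * R-matrices with left leg in a Hopf algebra over [H] *)

Section Trilinear.
Variables (k : fieldType) (U V W X : lmodType k).

Definition trilin (F : U -> V -> W -> X) :=
  [/\ forall v w, linear (fun u => F u v w), forall u w, linear (fun v => F u v w)
    & forall u v, linear (F u v)].

Definition tlift3 (F : U -> V -> W -> X) : ((U ⊗ V) ⊗ W)%type -> X :=
  tlift (fun z w => tlift (fun u v => F u v w) z).

Variable F : U -> V -> W -> X.
Hypothesis tF : trilin F.

Lemma tlift3_bilin : bilin (fun z w => tlift (fun u v => F u v w) z).
Proof. by case: tF => l1 l2 l3; split=> [w|z]; [apply: tlift_linear; lin|lin]. Qed.

Lemma tlift3E z w : tlift3 F (z ⊗ w) = tlift (fun u v => F u v w) z.
Proof. exact: (tliftE _ _ tlift3_bilin). Qed.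

Lemma tlift3_linear : linear (tlift3 F).
Proof. exact: (tlift_linear tlift3_bilin). Qed.

Lemma tlift3_assoc u z : tlift3 F (tassoc (u ⊗ z)) = tlift (F u) z.
Proof.
case: tF => l1 l2 l3; rewrite /tassoc tliftE; last by lin.
rewrite (linear_tlift _ _ tlift3_linear); apply: eq_tlift => v w.
by rewrite tlift3E tliftE //; split.
Qed.

End Trilinear.

Ltac trilin := split; lin.

(** An R-matrix [\sum_j a j ⊗ b j] in [L ⊗ H], for a Hopf algebra [L] mapped to
    [H] by [i]: this is what the smash product with [L] uses, since its elements
    involve left factors in [L] while right factors only act. The axioms are
    stated as identities of sums under an arbitrary multilinear map, which is
    how they enter computations. *)
Record left_R_matrix (k : fieldType) (L H : algType k) (hL : hopf_algebra L)
    (hH : hopf_algebra H) (i : L -> H) n (a : 'I_n -> L) (b : 'I_n -> H) : Prop :=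
  LeftRMatrix {
  R_comul_l : forall (X : lmodType k) (F : L -> L -> H -> X), trilin F ->
    \sum_j tlift (fun x y => F x y (b j)) (comul hL (a j)) =
    \sum_j \sum_l F (a j) (a l) (b j * b l);
  R_comul_r : forall (X : lmodType k) (F : L -> H -> H -> X), trilin F ->
    \sum_j tlift (F (a j)) (comul hH (b j)) =
    \sum_j \sum_l F (a j * a l) (b l) (b j);
  R_cocomm : forall (X : lmodType k) (F : L -> H -> X) h, bilin F ->
    tlift (fun x y => \sum_j F (y * a j) (i x * b j)) (comul hL h) =
    tlift (fun x y => \sum_j F (a j * x) (b j * i y)) (comul hL h);
  R_counit_l : \sum_j (counit hL (a j) : k) *: b j = 1;
  R_counit_r : \sum_j (counit hH (b j) : k) *: a j = 1
}.

Section RAntipode.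
Variables (k : fieldType) (L H : algType k) (hL : hopf_algebra L).
Variables (hH : hopf_algebra H) (i : L -> H) (n : nat).
Variables (a : 'I_n -> L) (b : 'I_n -> H).
Hypothesis RR : left_R_matrix hL hH i a b.
Variables (X : lmodType k) (F : L -> H -> X).
Hypothesis bF : bilin F.

Let F1 h : linear (fun x => F x h). Proof. exact: bF.1. Qed.
Let F2 x : linear (F x). Proof. exact: bF.2. Qed.

Lemma R_counit_lin : \sum_j (counit hL (a j) : k) *: F 1 (b j) = F 1 1.
Proof.
rewrite -[in RHS](R_counit_l RR) (linear_sum_at _ _ (F2 1)).
by apply: eq_bigr => j _; rewrite (linearZ_at _ _ (F2 1)).
Qed.

(** The tensor [(S ⊗ id) R] is a left inverse, and below a right inverse, of [R]. *)
Lemma R_antip_l :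
  \sum_j \sum_l F (antip hL (a j) * a l) (b j * b l) = F 1 1.
Proof.
pose G x y z := F (antip hL x * y) z.
have tG : trilin G by rewrite /G; trilin.
rewrite -(R_comul_l RR tG) -R_counit_lin.
apply: eq_bigr => j _; rewrite /G.
exact: (antip_l_lin hL (F1 (b j)) (a j)).
Qed.

Lemma R_antip_r :
  \sum_j \sum_l F (a j * antip hL (a l)) (b j * b l) = F 1 1.
Proof.
pose G x y z := F (x * antip hL y) z.
have tG : trilin G by rewrite /G; trilin.
rewrite -(R_comul_l RR tG) -R_counit_lin.
apply: eq_bigr => j _; rewrite /G.
exact: (antip_r_lin hL (F1 (b j)) (a j)).
Qed.

End RAntipode.

Section Universal.
Variables (k : fieldType) (H : algType k) (hH : hopf_algebra H).
Local Notation Δ := (comul hH).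
Local Notation ε := (counit hH).
Local Notation S := (antip hH).
Variables (n : nat) (a b : 'I_n -> H).
Hypothesis qtR : quasitriangular hH (\sum_j a j ⊗ b j).
Local Notation R := (\sum_j a j ⊗ b j).

Let unitR : exists R', R * R' = 1 /\ R' * R = 1. Proof. by case: qtR. Qed.

Lemma R_cancel (z : (H ⊗ H)%type) : R = z * R -> z = 1.
Proof.
by have [R' [RR' _]] := unitR => E; rewrite -[z]mulr1 -RR' mulrA -E.
Qed.

Lemma qt_comul_l (X : lmodType k) (F : H -> H -> H -> X) : trilin F ->
  \sum_j tlift (fun x y => F x y (b j)) (Δ (a j)) =
  \sum_j \sum_l F (a j) (a l) (b j * b l).
Proof.
case: qtR => _ E _ _ tF; have := congr1 (tlift3 F) E.
have -> : tmap Δ id R = \sum_j Δ (a j) ⊗ b j.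
  by rewrite /tmap tlift_sumE //; lin.
rewrite (linear_sum_at _ _ (tlift3_linear tF)).
under eq_bigr do rewrite (tlift3E tF).
move=> ->; rewrite /R13 /R23 !tlift_sumE; [|lin..].
rewrite mulr_suml (linear_sum_at _ _ (tlift3_linear tF)).
apply: eq_bigr => j _; rewrite mulr_sumr (linear_sum_at _ _ (tlift3_linear tF)).
apply: eq_bigr => l _; rewrite !tens_mulE mulr1 mul1r (tlift3E tF) tliftE //.
by case: tF.
Qed.

Lemma qt_comul_r (X : lmodType k) (F : H -> H -> H -> X) : trilin F ->
  \sum_j tlift (F (a j)) (Δ (b j)) =
  \sum_j \sum_l F (a j * a l) (b l) (b j).
Proof.
case: qtR => _ _ E _ tF; have := congr1 (tlift3 F) E.
have lA : linear (tassoc (U:=H) (V:=H) (W:=H)) by apply: tlift_linear; lin.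
have -> : tmap id Δ R = \sum_j a j ⊗ Δ (b j).
  by rewrite /tmap tlift_sumE //; lin.
rewrite (linear_sum_at _ _ lA) (linear_sum_at _ _ (tlift3_linear tF)).
under eq_bigr do rewrite (tlift3_assoc tF).
move=> ->; rewrite /R13 /R12 tlift_sumE; last by lin.
rewrite mulr_suml (linear_sum_at _ _ (tlift3_linear tF)).
apply: eq_bigr => j _.
rewrite (linear_sum_at _ _ (@linear_tensorl _ (H ⊗ H)%type H 1)) mulr_sumr.
rewrite (linear_sum_at _ _ (tlift3_linear tF)).
apply: eq_bigr => l _; rewrite !tens_mulE mulr1 mul1r (tlift3E tF) tliftE //.
by case: tF.
Qed.

(** Applying [ε] to the hexagon identities shows that [(ε ⊗ id) R], and likewise
    [(id ⊗ ε) R], multiplies [R] to itself; and [R] can be cancelled. *)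
Lemma qt_counit_l : \sum_j (ε (a j) : k) *: b j = 1.
Proof.
set e := LHS; suff /(congr1 (tlift (fun x y => (ε x : k) *: y))) : 1 ⊗ e = 1 :> (H ⊗ H)%type.
  by rewrite !tliftE; [rewrite rmorph1 !scale1r|lin..].
apply: R_cancel.
have tF : trilin (fun x y z => (ε x : k) *: (y ⊗ z : (H ⊗ H)%type)) by trilin.
have := qt_comul_l tF.
under eq_bigr => j _ do rewrite (counit_l_lin _ (@linear_tensorl _ H H (b j))).
move=> E; rewrite [LHS]E exchange_big mulr_sumr; apply: eq_bigr => l _.
rewrite tens_mulE mul1r /e mulr_suml (linear_sum_at _ _ (@linear_tensorr _ H H _)).
by apply: eq_bigr => j _; rewrite -scalerAl tensZr.
Qed.

Lemma qt_counit_r : \sum_j (ε (b j) : k) *: a j = 1.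
Proof.
set e := LHS; suff /(congr1 (tlift (fun x y => (ε y : k) *: x))) : e ⊗ 1 = 1 :> (H ⊗ H)%type.
  by rewrite !tliftE; [rewrite rmorph1 !scale1r|lin..].
apply: R_cancel.
have tF : trilin (fun x y z => (ε z : k) *: (x ⊗ y : (H ⊗ H)%type)) by trilin.
have := qt_comul_r tF.
under eq_bigr => j _ do rewrite (counit_r_lin _ (@linear_tensorr _ H H (a j))).
move=> E; rewrite [LHS]E exchange_big mulr_sumr; apply: eq_bigr => l _.
rewrite tens_mulE mul1r /e mulr_suml (linear_sum_at _ _ (@linear_tensorl _ H H _)).
by apply: eq_bigr => j _; rewrite -scalerAl tensZl.
Qed.

Lemma qt_cocomm (X : lmodType k) (F : H -> H -> X) h : bilin F ->
  tlift (fun x y => \sum_j F (y * a j) (x * b j)) (Δ h) =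
  tlift (fun x y => \sum_j F (a j * x) (b j * y)) (Δ h).
Proof.
case: qtR => _ _ _ /(_ h) E bF; have := congr1 (tlift F) E.
rewrite !tlift_mul // /tswap tlift_tlift //; last by lin.
have bl x y : bilin (fun a' b' => F (x * a') (y * b')) by lin.
have br x y : bilin (fun a' b' => F (a' * x) (b' * y)) by lin.
rewrite [X in _ = X]exchange_tlift => E'.
transitivity (tlift (fun u v => tlift (fun a0 b0 =>
   tlift (fun a' b' => F (a0 * a') (b0 * b')) R) (v ⊗ u)) (Δ h)).
  apply: eq_tlift => x y; rewrite tliftE ?tlift_sumE //; lin.
by rewrite {}E'; apply: eq_tlift => x y; rewrite tlift_sumE.
Qed.

Lemma qt_left_R_matrix : left_R_matrix hH hH id a b.
Proof.
split; [exact: qt_comul_l|exact: qt_comul_r|exact: qt_cocomm|exact: qt_counit_l|].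
exact: qt_counit_r.
Qed.

(** Both [R] and [(S ⊗ S) R] are inverse to [(S ⊗ id) R]. *)
Lemma qt_antip_antip : R = \sum_j S (a j) ⊗ S (b j).
Proof.
pose Q : (H ⊗ H)%type := \sum_j S (a j) ⊗ b j.
have RQ : R * Q = 1.
  rewrite mulr_suml -[RHS](R_antip_r qt_left_R_matrix (tensor_bilin H H)).
  apply: eq_bigr => j _; rewrite mulr_sumr.
  by apply: eq_bigr => l _; rewrite tens_mulE.
suff QW : Q * (\sum_j S (a j) ⊗ S (b j)) = 1 by rewrite -[LHS]mulr1 -QW mulrA RQ mul1r.
have tF : trilin (fun x y z : H => S x ⊗ (y * S z) : (H ⊗ H)%type) by trilin.
transitivity (\sum_j \sum_l S (a j * a l) ⊗ (b l * S (b j)) : (H ⊗ H)%type).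
  rewrite exchange_big mulr_suml; apply: eq_bigr => j _; rewrite mulr_sumr.
  by apply: eq_bigr => l _; rewrite tens_mulE antipM.
rewrite -(qt_comul_r tF).
under eq_bigr => j _ do rewrite (antip_r_lin _ (@linear_tensorr _ H H (S (a j)))).
transitivity (S (\sum_j (ε (b j) : k) *: a j) ⊗ (1 : H) : (H ⊗ H)%type); last first.
  by rewrite qt_counit_r antip1.
rewrite linear_sum (linear_sum_at _ _ (@linear_tensorl _ H H _)).
by apply: eq_bigr => j _; rewrite linearZ /= tensZl.
Qed.

End Universal.

(** * The smash product *)

Lemma tlift_mull (k : fieldType) (U V : lmodType k) (A : algType k)
    (f : U -> V -> A) x z : tlift f x * z = tlift (fun u v => f u v * z) x.
Proof. exact: (linear_tlift _ _ (@linear_mull _ A z)). Qed.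

Lemma tlift_mulr (k : fieldType) (U V : lmodType k) (A : algType k)
    (f : U -> V -> A) x z : z * tlift f x = tlift (fun u v => z * f u v) x.
Proof. exact: (linear_tlift _ _ (@linear_mulr _ A z)). Qed.

Section SmashProduct.
Variables (k : fieldType) (L V : algType k) (hL : hopf_algebra L).
Variable aV : module_algebra hL V.
Local Notation T := (smash_product aV).
Local Notation Δ := (comul hL).
Local Notation ε := (counit hL).
Local Notation S := (antip hL).

Definition sm (v : V) (l : L) : T := v ⊗ l.
Definition smV (v : V) : T := sm v 1.
Definition smL (l : L) : T := sm 1 l.

Lemma linear_sml l : linear (fun v => sm v l). Proof. exact: linear_tensorl. Qed.
Lemma linear_smr v : linear (sm v). Proof. exact: linear_tensorr. Qed.
Lemma linear_smV : linear smV. Proof. exact: linear_sml. Qed.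
Lemma linear_smL : linear smL. Proof. exact: linear_smr. Qed.

Lemma sm_ind (Q : T -> Prop) : (forall v l, Q (sm v l)) ->
  (forall x y, Q x -> Q y -> Q (x + y)) -> forall x, Q x.
Proof. exact: tens_ind. Qed.

End SmashProduct.

Ltac lin_smash :=
  lazymatch goal with
  | |- GRing.linear_for _ (fun v => sm _ v _) => exact: linear_sml
  | |- GRing.linear_for _ (sm _ _) => exact: linear_smr
  | |- GRing.linear_for _ (smV _) => exact: linear_smV
  | |- GRing.linear_for _ (smL _) => exact: linear_smL
  end.
Ltac lin_more ::= lin_smash.

Section SmashTheory.
Variables (k : fieldType) (L V : algType k) (hL : hopf_algebra L).
Variable aV : module_algebra hL V.
Local Notation T := (smash_product aV).
Local Notation Δ := (comul hL).
Local Notation ε := (counit hL).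
Local Notation S := (antip hL).
Local Notation "v # l" := (sm aV v l) (at level 30).
Local Notation α := (smV aV).
Local Notation ι := (smL aV).

Lemma smM v l w m :
  (v # l) * (w # m) = tlift (fun x y => (v * act aV x w) # (y * m)) (Δ l).
Proof. exact: smash_mulE. Qed.

Lemma smV1 : α 1 = 1. Proof. by []. Qed.
Lemma smL1 : ι 1 = 1. Proof. by []. Qed.

Lemma smV_sm v w l : α v * (w # l) = (v * w) # l.
Proof. by rewrite /smV smM rmorph1 tliftE ?act1 ?mul1r //; lin. Qed.

Lemma smE v l : v # l = α v * ι l.
Proof. by rewrite smV_sm mulr1. Qed.

Lemma smVM v w : α (v * w) = α v * α w.
Proof. by rewrite [RHS]smV_sm. Qed.

Lemma sm_smL v l m : (v # l) * ι m = v # (l * m).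
Proof.
rewrite /smL smM -[in RHS](counit_l hL l) tlift_mull.
rewrite (linear_tlift _ _ (linear_smr aV v)).
apply: eq_tlift => x y; rewrite act_one -scalerAl (linearZ_at _ _ (linear_smr aV _)).
by rewrite -scalerAr mulr1 (linearZ_at _ _ (linear_sml aV _)).
Qed.

Lemma smLM l m : ι (l * m) = ι l * ι m.
Proof. by rewrite [RHS]sm_smL. Qed.

Lemma smL_smV l v : ι l * α v = tlift (fun x y => act aV x v # y) (Δ l).
Proof. by rewrite smM; apply: eq_tlift => x y; rewrite mul1r mulr1. Qed.

(** In the smash product the action is inner: it is conjugation by [L]. *)
Lemma smV_act l v :
  α (act aV l v) = tlift (fun x y => ι x * α v * ι (S y)) (Δ l).
Proof.
transitivity (tlift (fun x y => tlift (fun p q => α (act aV p v) * ι (q * S y)) (Δ x)) (Δ l)).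
  have l1 : linear (fun x => α (act aV x v)) by lin.
  rewrite tlift_coassoc; [|lin..].
  rewrite -(counit_r_lin hL l1); apply: eq_tlift => x y.
  have lG : linear (fun z => α (act aV x v) * ι z) by lin.
  by rewrite (antip_r_lin hL lG) smL1 mulr1.
apply: eq_tlift => x y; rewrite smL_smV tlift_mull.
by apply: eq_tlift => p q; rewrite smE -mulrA smLM.
Qed.

(** The exchange relation [smL_smV] solved for the product in the other order. *)
Lemma smL_antip_act l v :
  tlift (fun x y => ι (S x) * α (act aV y v)) (Δ l) = α v * ι (S l).
Proof.
have lG : linear (fun z => α v * ι (S z)) by lin.
rewrite -(counit_l_lin hL lG).
transitivity (tlift (fun x y => tlift (fun p q => ι (S x) * (ι p * α v * ι (S q))) (Δ y)) (Δ l)).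
  by apply: eq_tlift => x y; rewrite smV_act tlift_mulr.
rewrite -tlift_coassoc; [|lin..].
apply: eq_tlift => x y.
have lG' : linear (fun z => ι z * (α v * ι (S y))) by lin.
have := antip_l_lin hL lG' x; rewrite smL1 mul1r => <-.
by apply: eq_tlift => p q; rewrite smLM !mulrA.
Qed.

End SmashTheory.

(** * The target map *)

Lemma tlift_bigsum (k : fieldType) (U V X : lmodType k) I (r : seq I)
    (f : I -> U -> V -> X) x :
  tlift (fun u v => \sum_(j <- r) f j u v) x = \sum_(j <- r) tlift (f j) x.
Proof.
rewrite tlift_sum; under eq_bigr do rewrite scaler_sumr.
by rewrite exchange_big; apply: eq_bigr => j _; rewrite tlift_sum.
Qed.

Section TargetMap.
Variables (k : fieldType) (L H V : algType k).
Variables (hL : hopf_algebra L) (hH : hopf_algebra H) (i : {lrmorphism L -> H}).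
Variables (hi : hopf_morphism hL hH i) (aV : module_algebra hH V).
Variables (n : nat) (a : 'I_n -> L) (b : 'I_n -> H).

(** The target map: the coaction of [L] on [V] induced by the action and [R]. *)
Definition sm_target (v : V) : smash_product (restriction hi aV) :=
  \sum_j sm (restriction hi aV) (act aV (b j) v) (a j).

Lemma linear_sm_target : linear sm_target.
Proof. by rewrite /sm_target; lin. Qed.

End TargetMap.

Ltac lin_more ::=
  lazymatch goal with
  | |- GRing.linear_for _ (sm_target _ _ _ _) => exact: linear_sm_target
  | |- _ => lin_smash
  end.

Section TargetTheory.
Variables (k : fieldType) (L H V : algType k).
Variables (hL : hopf_algebra L) (hH : hopf_algebra H) (i : {lrmorphism L -> H}).
Variables (hi : hopf_morphism hL hH i) (aV : module_algebra hH V).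
Variables (n : nat) (a : 'I_n -> L) (b : 'I_n -> H).
Hypothesis RR : left_R_matrix hL hH i a b.
Local Notation aL := (restriction hi aV).
Hypothesis qc : forall v w : V,
  v * w = \sum_j act aV (b j) w * act aL (a j) v.
Local Notation T := (smash_product aL).
Local Notation Δ := (comul hL).
Local Notation ε := (counit hL).
Local Notation S := (antip hL).
Local Notation "v # l" := (sm aL v l) (at level 30).
Local Notation α := (smV aL).
Local Notation ι := (smL aL).
Local Notation β := (sm_target hi aV a b).

Lemma sm_target1 : β 1 = 1.
Proof.
rewrite /sm_target; under eq_bigr do rewrite act_one.
rewrite -[RHS]/(1 # 1) -[in RHS](R_counit_r RR).
rewrite (linear_sum_at _ _ (linear_smr aL 1)); apply: eq_bigr => j _.
by rewrite (linearZ_at _ _ (linear_sml aL _)) (linearZ_at _ _ (linear_smr aL _)).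
Qed.

(** The first hexagon identity splits the action of [R^1] on [v], and quantum
    commutativity then reverses the product with [v]. *)
Lemma sm_target_smV v w : α v * β w = β w * α v.
Proof.
rewrite mulr_suml mulr_sumr; under [RHS]eq_bigr do rewrite smM.
pose F x y z := (act aV z w * act aL x v) # (y * 1).
have tF : trilin F by rewrite /F; trilin.
rewrite [RHS](R_comul_l RR tF) exchange_big; apply: eq_bigr => l _.
rewrite smV_sm qc -(linear_sum_at _ _ (linear_sml aL _)) /F mulr1.
by congr (_ # _); apply: eq_bigr => j _; rewrite actM.
Qed.

(** The second hexagon identity expands the action on [v * w], the first one the
    product of the targets; the results differ by quantum commutativity. *)
Lemma sm_targetM v w : β (v * w) = β w * β v.
Proof.
rewrite mulr_suml; under [RHS]eq_bigr => j _ do rewrite mulr_sumr.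
pose F x y z := (act aV y v * act aV z w) # x.
have tF : trilin F by rewrite /F; trilin.
transitivity (\sum_j tlift (F (a j)) (comul hH (b j))).
  apply: eq_bigr => j _.
  by rewrite act_mul (linear_tlift _ _ (linear_sml aL _)).
rewrite (R_comul_r RR tF) exchange_big [RHS]exchange_big /=; apply: eq_bigr => l _.
pose G x y z := (act aV z w * act aL x (act aV (b l) v)) # (y * a l).
have tG : trilin G by rewrite /G; trilin.
under [RHS]eq_bigr do rewrite smM.
rewrite [RHS](R_comul_l RR tG) exchange_big; apply: eq_bigr => j _.
rewrite /F /G qc (linear_sum_at _ _ (linear_sml aL _)).
by apply: eq_bigr => m _; rewrite actM.
Qed.

Lemma sm_target_smL v l : β v * ι l = \sum_j act aV (b j) v # (a j * l).
Proof. by rewrite mulr_suml; apply: eq_bigr => j _; rewrite sm_smL. Qed.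

(** This is the axiom [Δ^cop R = R Δ], with its right factors acting on [v]. *)
Lemma smL_target l v :
  ι l * β v = tlift (fun x y => β (act aL y v) * ι x) (Δ l).
Proof.
rewrite mulr_sumr; under eq_bigr do rewrite smM.
rewrite -tlift_bigsum.
pose F x h := act aV h v # x.
have bF : bilin F by rewrite /F; lin.
have := R_cocomm RR l bF; rewrite /F => E.
transitivity (tlift (fun x y => \sum_j act aV (i x * b j) v # (y * a j)) (Δ l)).
  apply: eq_tlift => x y; apply: eq_bigr => j _.
  by rewrite mul1r actM.
rewrite E; apply: eq_tlift => x y; rewrite sm_target_smL.
by apply: eq_bigr => j _; rewrite actM.
Qed.

(** The relation [smL_target] solved for the product in the other order. *)
Lemma target_smL v l :
  β v * ι l = tlift (fun x y => ι x * β (act aL (S y) v)) (Δ l).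
Proof.
transitivity (tlift (fun x y => tlift (fun p q => β (act aL (p * S q) v) * ι x) (Δ y)) (Δ l)).
  have lG : linear (fun x => β v * ι x) by lin.
  rewrite -(counit_r_lin hL lG); apply: eq_tlift => x y.
  have lG' : linear (fun z => β (act aL z v) * ι x) by lin.
  by rewrite (antip_r_lin hL lG') act1.
rewrite -tlift_coassoc; [|lin..].
apply: eq_tlift => x y; rewrite smL_target; apply: eq_tlift => p q.
by rewrite actM.
Qed.

(** The analogue of [smV_act] for the target map: the action of the antipode
    becomes right conjugation. *)
Lemma target_act_antip l v :
  β (act aL (S l) v) = tlift (fun x y => ι (S x) * β v * ι y) (Δ l).
Proof.
have lG : linear (fun z => β (act aL (S z) v)) by lin.
rewrite -(counit_l_lin hL lG).
transitivity (tlift (fun x y => tlift (fun p q =>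
  ι (S x) * (ι p * β (act aL (S q) v))) (Δ y)) (Δ l)); last first.
  by apply: eq_tlift => x y; rewrite -mulrA target_smL tlift_mulr.
rewrite -tlift_coassoc; [|lin..].
apply: eq_tlift => x y.
have lG' : linear (fun z => ι z * β (act aL (S y) v)) by lin.
have := antip_l_lin hL lG' x; rewrite smL1 mul1r => <-.
by apply: eq_tlift => p q; rewrite smLM !mulrA.
Qed.

End TargetTheory.

(** * The coproduct *)

Lemma tlift_linear_tensor (k : fieldType) (U V X : lmodType k)
    (h : (U ⊗ V)%type -> X) z :
  linear h -> tlift (fun u v => h (u ⊗ v)) z = h z.
Proof.
move=> lh; have bf : bilin (fun u v => h (u ⊗ v)) by lin.
elim/tens_ind: z => [u v|x y Hx Hy]; first exact: tliftE.
by rewrite tliftD // Hx Hy (linearD_at _ _ lh).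
Qed.

Section LiftedCoproduct.
Variables (k : fieldType) (B T : algType k) (alpha beta : B -> T).
Local Notation TB := (TT alpha beta).
Local Notation π := (bproj (right_act beta) (left_act alpha)).
Local Notation "s ⊠ t" := (TT_tensor alpha beta s t) (at level 40).

Lemma TT_bal c s t : (beta c * s) ⊠ t = s ⊠ (alpha c * t).
Proof. exact: bproj_bal. Qed.

(** Right multiplication, unlike left multiplication, always descends to the
    balanced tensor product. *)
Lemma TT_rmul_bproj z y : TT_rmul (π z : TB) y = π (z * y).
Proof.
rewrite /TT_rmul blift_bproj.
- transitivity (tlift (fun t t' => π ((t ⊗ t') * y)) z).
    apply: eq_tlift => t t'.
    rewrite -(tlift_linear_tensor (h := fun y => π ((t ⊗ t') * y))); last by lin.
    by apply: eq_tlift => s s'; rewrite tens_mulE.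
  by apply: (tlift_linear_tensor (h := fun z => π (z * y))); lin.
- by rewrite /TT_tensor /btensor; lin.
- move=> c t t'; apply: eq_tlift => s s'.
  by rewrite /right_act /left_act -!mulrA TT_bal.
Qed.

Variable cop : T -> (T ⊗ T)%type.
Hypotheses (lcop : linear cop) (copM : {morph cop : s t / s * t}).
Hypothesis copB : forall s c t t',
  π (cop s * ((beta c * t) ⊗ t')) = π (cop s * (t ⊗ (alpha c * t'))).

Definition lift_comul (s : T) : TB := π (cop s).

(** Left multiplication by [cop s] on the balanced tensor product, which is not
    an algebra; well defined by [copB]. *)
Definition lift_op (s : T) : TB -> TB := blift (fun t t' => π (cop s * (t ⊗ t'))).

Lemma lift_op_bproj s z : lift_op s (π z) = π (cop s * z).
Proof.
rewrite /lift_op blift_bproj.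
- by apply: (tlift_linear_tensor (h := fun z => π (cop s * z))); lin.
- by lin.
- by move=> c t t'; exact: copB.
Qed.

Lemma lift_comul_linear : linear lift_comul.
Proof. by rewrite /lift_comul; lin. Qed.

Lemma lift_comulM s t : lift_comul (s * t) = lift_op s (lift_comul t).
Proof. by rewrite /lift_comul copM lift_op_bproj. Qed.

Let P (t t' t'' : T) : TB := π (cop t * (t' ⊗ t'')).

Let trilinP : trilin (P : T -> T^c -> T^c -> TB).
Proof.
have : trilin P by rewrite /P; trilin.
by [].
Qed.

Let phi_tlift3 : phi lift_comul =1 tlift3 (P : T -> T^c -> T^c -> TB).
Proof.
move=> x; apply: eq_tlift => z t''; apply: eq_tlift => t t'.
exact: TT_rmul_bproj.
Qed.

Lemma phiE (t t' t'' : T) :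
  phi lift_comul ((t ⊗ (t' : T^c)) ⊗ (t'' : T^c)) = P t t' t''.
Proof.
rewrite phi_tlift3 (tlift3E trilinP) tliftE //.
by case: trilinP => l1 l2 _; split=> x; [exact: l1 | exact: l2].
Qed.

Lemma phi_linear : linear (phi lift_comul).
Proof. by move=> c x y; rewrite !phi_tlift3; exact: (tlift3_linear trilinP). Qed.

(** Left multiplication by a pure tensor in the source of [phi] corresponds to
    the operator [lift_op] followed by a right multiplication in the target, so
    it preserves the kernel. *)
Lemma lift_comul_ker : left_ideal (fun x => phi lift_comul x = 0).
Proof.
pose A : algType k := (T ⊗ T^c ⊗ T^c)%type.
have phiD : {morph (phi lift_comul : A -> TB) : x y / x + y}.
  by move=> x y; exact: (linearD_at x y phi_linear).
split; first exact: (linear0_at phi_linear).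
  by move=> x y; rewrite phiD => -> ->; rewrite addr0.
move=> c x x0; elim/tens_ind: c => [c s''|c d Hc Hd]; last first.
  by rewrite mulrDl phiD Hc Hd addr0.
elim/tens_ind: c => [s s'|c d Hc Hd]; last first.
  by rewrite tensDl mulrDl phiD Hc Hd addr0.
pose M (z : TB) := TT_rmul (lift_op s z) ((s' : T) ⊗ (s'' : T)).
have lM : linear M.
  move=> e z w; have [[z' ->] [w' ->]] := (bproj_surj z, bproj_surj w).
  rewrite /M -(bproj_linear _ _ e) !lift_op_bproj !TT_rmul_bproj.
  rewrite mulrDr mulrDl -scalerAr -scalerAl; exact: (bproj_linear _ _ e).
suff -> : phi lift_comul (((s ⊗ s') ⊗ s'') * x) = M (phi lift_comul x).
  by rewrite x0 (linear0_at lM).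
elim/tens_ind: x {x0} => [x t''|x y Hx Hy]; last first.
  by rewrite mulrDr !phiD Hx Hy (linearD_at _ _ lM).
elim/tens_ind: x => [t t'|x y Hx Hy]; last first.
  by rewrite tensDl mulrDr !phiD Hx Hy (linearD_at _ _ lM).
rewrite !tens_mulE !phiE /M /P lift_op_bproj TT_rmul_bproj copM.
by rewrite -!mulrA tens_mulE.
Qed.

End LiftedCoproduct.

Section SmashCop.
Variables (k : fieldType) (L V : algType k) (hL : hopf_algebra L).
Variable aV : module_algebra hL V.
Local Notation T := (smash_product aV).
Local Notation Δ := (comul hL).
Local Notation "v # l" := (sm aV v l) (at level 30).
Local Notation α := (smV aV).
Local Notation ι := (smL aV).

(** The coproduct before passing to the tensor product over [V], with values in
    an algebra, so that it can be multiplicative. *)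
Definition sm_cop (s : T) : (T ⊗ T)%type :=
  tlift (fun v l => tlift (fun x y => (v # x) ⊗ ι y) (Δ l)) s.

Lemma sm_copE v l : sm_cop (v # l) = tlift (fun x y => (v # x) ⊗ ι y) (Δ l).
Proof. by rewrite /sm_cop tliftE //; lin. Qed.

Lemma linear_sm_cop : linear sm_cop.
Proof. by rewrite /sm_cop; lin. Qed.

Lemma sm_copM s t : sm_cop (s * t) = sm_cop s * sm_cop t.
Proof.
elim/sm_ind: s => [v l|x y Hx Hy]; last first.
  by rewrite mulrDl !(linearD_at _ _ linear_sm_cop) Hx Hy mulrDl.
elim/sm_ind: t => [w m|x y Hx Hy]; last first.
  by rewrite mulrDr !(linearD_at _ _ linear_sm_cop) Hx Hy mulrDr.
rewrite smM (linear_tlift _ _ linear_sm_cop) !sm_copE tlift_mull.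
pose F x p q : (T ⊗ T)%type :=
  tlift (fun p' q' => ((v * act aV x w) # (p * p')) ⊗ ι (q * q')) (Δ m).
transitivity (tlift (fun x y => tlift (F x) (Δ y)) (Δ l)).
  apply: eq_tlift => x y; rewrite sm_copE rmorphM tlift_mul //; lin.
rewrite -tlift_coassoc; [|rewrite /F; lin..].
apply: eq_tlift => x y; rewrite /F exchange_tlift tlift_mulr.
apply: eq_tlift => p' q'; rewrite tens_mulE smM smLM.
by rewrite (linear_tlift _ _ (@linear_tensorl _ T T _)).
Qed.

Lemma sm_cop_smV v : sm_cop (α v) = α v ⊗ 1.
Proof. by rewrite sm_copE rmorph1 tliftE //; lin. Qed.

End SmashCop.

Section Coproduct.
Variables (k : fieldType) (L H V : algType k).
Variables (hL : hopf_algebra L) (hH : hopf_algebra H) (i : {lrmorphism L -> H}).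
Variables (hi : hopf_morphism hL hH i) (aV : module_algebra hH V).
Variables (n : nat) (a : 'I_n -> L) (b : 'I_n -> H).
Hypothesis RR : left_R_matrix hL hH i a b.
Local Notation aL := (restriction hi aV).
Hypothesis qc : forall v w : V,
  v * w = \sum_j act aV (b j) w * act aL (a j) v.
Local Notation T := (smash_product aL).
Local Notation Δ := (comul hL).
Local Notation ε := (counit hL).
Local Notation S := (antip hL).
Local Notation "v # l" := (sm aL v l) (at level 30).
Local Notation α := (smV aL).
Local Notation ι := (smL aL).
Local Notation β := (sm_target hi aV a b).
Local Notation TV := (TT α β).
Local Notation π := (bproj (right_act β) (left_act α)).
Local Notation "s ⊠ t" := (TT_tensor α β s t) (at level 40).

(** Left multiplication by an arbitrary tensor does not respect the balancing
    relation in general. For [sm_cop s] it does: moving [β c] to the left across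
    [l1] by [smL_target], then [α c] to the left across [l2] by [smL_smV], makes
    the same factor act on [c]. *)
Lemma sm_cop_bal s c t t' :
  π (sm_cop s * ((β c * t) ⊗ t')) = π (sm_cop s * (t ⊗ (α c * t'))).
Proof.
elim/sm_ind: s => [v l|x y Hx Hy]; last first.
  by rewrite !(linearD_at _ _ (@linear_sm_cop _ _ _ _ _)) !mulrDl
    !(linearD_at _ _ (bproj_linear _ _)) Hx Hy.
have lp : linear π by exact: bproj_linear.
rewrite sm_copE !tlift_mull !(linear_tlift _ _ lp).
pose F x y z := π (((v # x) * t) ⊗ (α (act aL y c) * ι z * t')).
transitivity (tlift (fun x y => tlift (fun p q => F p q y) (Δ x)) (Δ l)).
  apply: eq_tlift => x y; rewrite tens_mulE mulrA smE -(mulrA (α v)) (smL_target hi aV RR).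
  rewrite tlift_mulr tlift_mull (linear_tlift _ _ (@linear_tensorl _ T T _)).
  rewrite (linear_tlift _ _ lp); apply: eq_tlift => p q.
  rewrite mulrA (sm_target_smV RR qc) -!mulrA [LHS]TT_bal /F smE !mulrA.
  by [].
rewrite tlift_coassoc; [|rewrite /F; lin..].
apply: eq_tlift => x y; rewrite tens_mulE mulrA smL_smV.
rewrite tlift_mull (linear_tlift _ _ (@linear_tensorr _ T T _)).
rewrite (linear_tlift _ _ lp); apply: eq_tlift => p q.
by rewrite /F -smE.
Qed.

Definition sm_comul : T -> TV := lift_comul α β (sm_cop (aV := aL)).

Lemma sm_comul_linear : linmap sm_comul.
Proof. exact/lift_comul_linear/linear_sm_cop. Qed.

Lemma sm_comulE v l : sm_comul (v # l) = tlift (fun x y => (v # x) ⊠ ι y) (Δ l).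
Proof. by rewrite /sm_comul /lift_comul sm_copE (linear_tlift _ _ (bproj_linear _ _)). Qed.

Definition sm_op : T -> TV -> TV := lift_op (sm_cop (aV := aL)).

Lemma sm_op_bproj s z : sm_op s (π z) = π (sm_cop s * z).
Proof. exact/lift_op_bproj/sm_cop_bal. Qed.

Lemma sm_comulM s t : sm_comul (s * t) = sm_op s (sm_comul t).
Proof.
by apply: lift_comulM; [exact: sm_copM | exact: sm_cop_bal].
Qed.

Lemma sm_comul_ker : left_ideal (fun x => phi sm_comul x = 0).
Proof.
apply: lift_comul_ker;
  [exact: linear_sm_cop | exact: sm_copM | exact: sm_cop_bal].
Qed.

Lemma sm_comul_smV c t : sm_comul (α c * t) = TT_left c (sm_comul t).
Proof.
rewrite sm_comulM; have [z ->] := bproj_surj (sm_comul t).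
rewrite sm_op_bproj sm_cop_smV /TT_left blift_bproj.
- rewrite -(tlift_linear_tensor (h := fun z => π ((α c ⊗ 1) * z))); last by lin.
  by apply: eq_tlift => s s'; rewrite tens_mulE mul1r.
- by rewrite /TT_tensor /btensor /left_act; lin.
- move=> d s s'; rewrite /right_act /left_act.
  by rewrite mulrA (sm_target_smV RR qc) -mulrA TT_bal.
Qed.

(** The first hexagon identity. Over [V] the sum becomes [1 ⊠ β c], which is why
    the coproduct is linear with respect to the target map. *)
Lemma sm_cop_target c : sm_cop (β c) = \sum_l β (act aV (b l) c) ⊗ ι (a l).
Proof.
rewrite (linear_sum_at _ _ (@linear_sm_cop _ _ _ _ _)).
under eq_bigr do rewrite sm_copE.
pose F x y z : (T ⊗ T)%type := (act aV z c # x) ⊗ ι y.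
have tF : trilin F by rewrite /F; trilin.
rewrite (R_comul_l RR tF) exchange_big; apply: eq_bigr => l _.
rewrite (linear_sum_at _ _ (@linear_tensorl _ T T _)).
by apply: eq_bigr => j _; rewrite /F actM.
Qed.

Lemma sm_comul_target c t : sm_comul (β c * t) = TT_right c (sm_comul t).
Proof.
have lp : linear π by exact: bproj_linear.
rewrite sm_comulM; have [z ->] := bproj_surj (sm_comul t).
rewrite sm_op_bproj sm_cop_target /TT_right blift_bproj.
- rewrite -(tlift_linear_tensor
    (h := fun z => π ((\sum_l β (act aV (b l) c) ⊗ ι (a l)) * z))); last by lin.
  apply: eq_tlift => s s'; rewrite mulr_suml (linear_sum_at _ _ lp).
  under eq_bigr do rewrite tens_mulE [π _]TT_bal mulrA -smE.
  rewrite /right_act /sm_target mulr_suml /TT_tensor.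
  by rewrite (linear_sum_at _ _ (linear_btensorr _ _ _)).
- by rewrite /TT_tensor /btensor /right_act; lin.
- move=> d s s'; rewrite /right_act /left_act.
  by rewrite TT_bal (mulrA (α d)) (sm_target_smV RR qc) -mulrA.
Qed.

End Coproduct.

(** * The counit *)

Section Counit.
Variables (k : fieldType) (L V : algType k) (hL : hopf_algebra L).
Variable aV : module_algebra hL V.
Local Notation T := (smash_product aV).
Local Notation Δ := (comul hL).
Local Notation ε := (counit hL).
Local Notation "v # l" := (sm aV v l) (at level 30).
Local Notation α := (smV aV).
Local Notation ι := (smL aV).

Definition sm_counit (s : T) : V := tlift (fun v l => (ε l : k) *: v) s.

(** The action of the smash product on [V] extending that of [L]. The counit is
    its value at [1], which is why it is compatible with left multiplication. *)
Definition sm_act (s : T) (w : V) : V := tlift (fun v l => v * act aV l w) s.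

Lemma sm_counitE v l : sm_counit (v # l) = (ε l : k) *: v.
Proof. by rewrite /sm_counit tliftE //; lin. Qed.

Lemma sm_actE v l w : sm_act (v # l) w = v * act aV l w.
Proof. by rewrite /sm_act tliftE //; lin. Qed.

Lemma linear_sm_counit : linear sm_counit.
Proof. by rewrite /sm_counit; lin. Qed.

Lemma linear_sm_actl w : linear (fun s => sm_act s w).
Proof. by rewrite /sm_act; lin. Qed.

Lemma linear_sm_actr s : linear (sm_act s).
Proof. by rewrite /sm_act; lin. Qed.

Lemma sm_counitM s t : sm_counit (s * t) = sm_act s (sm_counit t).
Proof.
elim/sm_ind: s => [v l|x y Hx Hy]; last first.
  by rewrite mulrDl (linearD_at _ _ linear_sm_counit) Hx Hy
    (linearD_at _ _ (linear_sm_actl _)).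
elim/sm_ind: t => [w m|x y Hx Hy]; last first.
  by rewrite mulrDr !(linearD_at _ _ linear_sm_counit) Hx Hy
    (linearD_at _ _ (linear_sm_actr _)).
rewrite sm_counitE sm_actE (linearZ_at _ _ (linear_actr aV l)) -scalerAr smM.
have lG : linear (fun x => v * act aV x w) by lin.
rewrite (linear_tlift _ _ linear_sm_counit) -(counit_r_lin hL lG).
rewrite (linear_tlift _ _ (@linear_scaler _ V _)).
apply: eq_tlift => x y.
rewrite sm_counitE rmorphM scalerA; congr (_ *: _); exact: mulrC.
Qed.

Lemma sm_counit_smV v s : sm_counit (α v * s) = v * sm_counit s.
Proof. by rewrite sm_counitM sm_actE act1. Qed.

Lemma sm_counit_smL l : sm_counit (ι l) = (ε l : k) *: 1.
Proof. exact: sm_counitE. Qed.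

End Counit.

Section Bialgebroid.
Variables (k : fieldType) (L H V : algType k).
Variables (hL : hopf_algebra L) (hH : hopf_algebra H) (i : {lrmorphism L -> H}).
Variables (hi : hopf_morphism hL hH i) (aV : module_algebra hH V).
Variables (n : nat) (a : 'I_n -> L) (b : 'I_n -> H).
Hypothesis RR : left_R_matrix hL hH i a b.
Local Notation aL := (restriction hi aV).
Hypothesis qc : forall v w : V,
  v * w = \sum_j act aV (b j) w * act aL (a j) v.
Local Notation T := (smash_product aL).
Local Notation Δ := (comul hL).
Local Notation ε := (counit hL).
Local Notation S := (antip hL).
Local Notation "v # l" := (sm aL v l) (at level 30).
Local Notation α := (smV aL).
Local Notation ι := (smL aL).
Local Notation β := (sm_target hi aV a b).
Local Notation TV := (TT α β).
Local Notation π := (bproj (right_act β) (left_act α)).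
Local Notation "s ⊠ t" := (TT_tensor α β s t) (at level 40).
Local Notation DT := (sm_comul (hi := hi) (aV := aV) a b).
Local Notation εT := (sm_counit (aV := aL)).

(** Here quantum commutativity is the statement that [β c] acts on [V] as right
    multiplication by [c]. *)
Lemma sm_counit_target c s : εT (β c * s) = εT s * c.
Proof.
rewrite sm_counitM (linear_sum_at _ _ (linear_sm_actl _)) qc.
by apply: eq_bigr => j _; rewrite sm_actE.
Qed.

Lemma sm_target_scale (c : k) : β (c *: 1) = c *: 1.
Proof. by rewrite (linearZ_at _ _ (linear_sm_target _ _ _ _)) (sm_target1 hi aV RR). Qed.

Lemma sm_counit_l s : blift (fun x y => α (εT x) * y) (DT s : TV) = s.
Proof.
have lε := @linear_sm_counit _ _ _ _ aL.
rewrite /sm_comul /lift_comul blift_bproj.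
- have bf : bilin (fun x y => α (εT x) * y) by lin.
  elim/sm_ind: s => [v l|x y Hx Hy]; last first.
    by rewrite (linearD_at _ _ (@linear_sm_cop _ _ _ _ _)) tliftD // Hx Hy.
  rewrite sm_copE tlift_tlift // -(counit_l_lin hL (linear_smr aL v)).
  apply: eq_tlift => x y; rewrite tliftE // sm_counitE.
  by rewrite (linearZ_at _ _ (linear_smV _)) -scalerAl -smE.
- by lin.
- move=> c x y; rewrite /right_act /left_act sm_counit_target smVM.
  by rewrite mulrA.
Qed.

Lemma sm_counit_r s : blift (fun x y => β (εT y) * x) (DT s : TV) = s.
Proof.
have lε := @linear_sm_counit _ _ _ _ aL.
rewrite /sm_comul /lift_comul blift_bproj.
- have bf : bilin (fun x y => β (εT y) * x) by lin.
  elim/sm_ind: s => [v l|x y Hx Hy]; last first.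
    by rewrite (linearD_at _ _ (@linear_sm_cop _ _ _ _ _)) tliftD // Hx Hy.
  rewrite sm_copE tlift_tlift // -(counit_r_lin hL (linear_smr aL v)).
  apply: eq_tlift => x y; rewrite tliftE // sm_counit_smL.
  by rewrite sm_target_scale -scalerAl mul1r.
- by lin.
- move=> c x y; rewrite /right_act /left_act sm_counit_smV (sm_targetM RR qc).
  by rewrite mulrA.
Qed.

(** * The bialgebroid structure *)

Lemma TT_left_linear c : linmap (TT_left c : TV -> TV).
Proof.
apply: linear_blift; first by rewrite /TT_tensor /btensor /left_act; lin.
move=> d s s'; rewrite /right_act /left_act.
by rewrite mulrA (sm_target_smV RR qc) -mulrA TT_bal.
Qed.

Lemma TT_leftE c s t : TT_left c (s ⊠ t) = (α c * s) ⊠ t.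
Proof.
rewrite /TT_left [LHS]bliftE //.
  by rewrite /TT_tensor /btensor /left_act; lin.
move=> d s' t'; rewrite /right_act /left_act.
by rewrite mulrA (sm_target_smV RR qc) -mulrA TT_bal.
Qed.

Lemma TT_rightE c s t : TT_right c (s ⊠ t) = s ⊠ (β c * t).
Proof.
rewrite /TT_right [LHS]bliftE //.
  by rewrite /TT_tensor /btensor /right_act; lin.
move=> d s' t'; rewrite /right_act /left_act.
by rewrite TT_bal (mulrA (α d)) (sm_target_smV RR qc) -mulrA.
Qed.

Let lD : linmap DT. Proof. exact: sm_comul_linear. Qed.

(** Both sides send [v # l] to the sum of the [(v # l1) ⊗ ι l2 ⊗ ι l3]. *)
Lemma sm_comulA s :
  blift (fun x y => btensor _ _ (DT x) y : TTT α β) (DT s) =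
  TT_assoc (blift (fun x y => btensor _ _ x (DT y) : TTT' α β) (DT s)).
Proof.
(* B1 and B2 are abstract so that unification does not unfold the quotients. *)
have [B1 B1E] : exists B1 : TV -> T -> TTT α β, B1 = btensor _ _ by eexists.
have [B2 B2E] : exists B2 : T -> TV -> TTT' α β, B2 = btensor _ _ by eexists.
have l1l y : linmap (fun x => B1 x y) by rewrite B1E; exact: linear_btensorl.
have l1r x : linmap (B1 x) by rewrite B1E; exact: linear_btensorr.
have l2l y : linmap (fun x => B2 x y) by rewrite B2E; exact: linear_btensorl.
have l2r x : linmap (B2 x) by rewrite B2E; exact: linear_btensorr.
have balB1 c x y : B1 (TT_right c x) y = B1 x (left_act α c y).
  by rewrite B1E; exact: bproj_bal.
have balB2 c x y : B2 (right_act β c x) y = B2 x (TT_left c y).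
  by rewrite B2E; exact: bproj_bal.
have lt y : linmap (fun x => x ⊠ y) by exact: linear_btensorl.
have lt' x : linmap (fun y => x ⊠ y) by exact: linear_btensorr.
pose A1 s t t' := B1 (s ⊠ t) t'.
have bA1 s' : bilin (A1 s').
  split=> [t'|t]; last exact: l1r.
  exact: (linear_compose (l1l t') (lt' s')).
have balA1 s' : balanced (right_act β) (left_act α) (A1 s').
  move=> c t t'. rewrite /A1. rewrite -balB1. congr (B1 _ t'). exact/esym/TT_rightE.
have bA : bilin (fun s => blift (A1 s) : TV -> TTT α β).
  split=> [z|s']; last exact: linear_blift (bA1 s') (balA1 s').
  have [y ->] := bproj_surj z; move=> c s1 s2.
  rewrite 3!(blift_bproj (bA1 _) (balA1 _)).
  move: c s1 s2; apply: tlift_linear_param => t t'.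
  exact: (linear_compose (l1l t') (lt t)).
have balA : balanced (right_act β) (@TT_left _ _ _ α β) (fun s => blift (A1 s) : TV -> TTT α β).
  move=> c s' z; elim/btens_ind: z => [t t'|x y Hx Hy]; last first.
    rewrite (linearD_at _ _ (TT_left_linear c)).
    rewrite 2!(linearD_at _ _ (linear_blift (bA1 _) (balA1 _))).
    exact: (congr2 +%R Hx Hy).
  rewrite [TT_left c _]TT_leftE 2!(bliftE _ _ (bA1 _) (balA1 _)).
  exact: (congr1 (B1^~ t') (TT_bal _ _ _ _ _)).
have TAE : @TT_assoc _ _ _ α β = blift (fun s : T => blift (A1 s) : TV -> TTT α β).
  rewrite /A1 B1E; reflexivity.
have lA : linmap (@TT_assoc _ _ _ α β) by rewrite TAE; exact: linear_blift bA balA.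
have AE x y z : TT_assoc (B2 x (y ⊠ z)) = B1 (x ⊠ y) z.
  rewrite TAE B2E; rewrite [LHS](bliftE _ _ bA balA).
  exact: (bliftE _ _ (bA1 _) (balA1 _)).
have bl : bilin (fun x y => B1 (DT x) y).
  by split=> [y|x]; [exact: (linear_compose (l1l y) lD) | exact: l1r].
have ball : balanced (right_act β) (left_act α) (fun x y => B1 (DT x) y).
  by move=> c x y; rewrite -balB1 -(sm_comul_target RR qc).
have br : bilin (fun x y => B2 x (DT y)).
  by split=> [y|x]; [exact: l2l | exact: (linear_compose (l2r x) lD)].
have balr : balanced (right_act β) (left_act α) (fun x y => B2 x (DT y)).
  by move=> c x y; rewrite balB2 -(sm_comul_smV RR qc).
suff : blift (fun x y => B1 (DT x) y) (DT s) =
    TT_assoc (blift (fun x y => B2 x (DT y)) (DT s)).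
  by rewrite B1E B2E; exact.
rewrite (blift_bproj bl ball) (blift_bproj br balr) (linear_tlift _ _ lA).
have bA12 : bilin (fun x y => TT_assoc (B2 x (DT y))).
  by split=> [y|x]; [exact: (linear_compose lA (br.1 y)) | exact: (linear_compose lA (br.2 x))].
have lcop := @linear_sm_cop _ _ _ _ aL.
elim/sm_ind: s => [v l|x y Hx Hy]; last first.
  rewrite (linearD_at _ _ lcop) (tliftD _ _ bl) (tliftD _ _ bA12).
  exact: (congr2 +%R Hx Hy).
rewrite sm_copE (tlift_tlift _ _ bl) (tlift_tlift _ _ bA12).
transitivity (tlift (fun x y => tlift (fun p q => B1 ((v # p) ⊠ ι q) (ι y)) (Δ x)) (Δ l)).
  apply: eq_tlift => x y; rewrite (tliftE _ _ bl) sm_comulE.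
  exact: (linear_tlift _ _ (l1l (ι y))).
rewrite tlift_coassoc.
- apply: eq_tlift => x y; rewrite (tliftE _ _ bA12) sm_comulE.
  rewrite (linear_tlift _ _ (l2r _)) (linear_tlift _ _ lA).
  apply: eq_tlift => p q; exact/esym/AE.
- move=> q y; apply: (linear_compose (l1l (ι y))).
  by apply: (linear_compose (lt (ι q))); exact: linear_smr.
- move=> p y; apply: (linear_compose (l1l (ι y))).
  by apply: (linear_compose (lt' (v # p))); exact: linear_smL.
- move=> p q; apply: (linear_compose (l1r _)); exact: linear_smL.
Qed.

Lemma sm_counit_ker : left_ideal (fun x => εT x = 0).
Proof.
have lε := @linear_sm_counit _ _ _ _ aL.
split; first by rewrite (linear0_at lε).
  by move=> x y; rewrite (linearD_at _ _ lε) => -> ->; rewrite addr0.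
by move=> s t t0; rewrite sm_counitM t0 (linear0_at (linear_sm_actr _)).
Qed.

Lemma sm_comul1 : DT 1 = 1 ⊠ 1.
Proof.
have bt : bilin (fun x y => (1 # x) ⊠ ι y) by rewrite /TT_tensor /btensor; lin.
by have := sm_comulE hi aV a b 1 1; rewrite rmorph1 (tliftE _ _ bt).
Qed.

Lemma sm_counit1 : εT 1 = 1.
Proof. by rewrite -(smL1 aL) sm_counit_smL rmorph1 scale1r. Qed.

HB.instance Definition _ := GRing.isLinear.Build k V T _ α (linear_smV aL).
HB.instance Definition _ := GRing.isMonoidMorphism.Build V T α (smV1 aL, smVM aL).

Definition smash_bialgebroid : bialgebroid V T :=
  @Bialgebroid k V T α (linpack (linear_sm_target hi aV a b))
    (sm_target1 hi aV RR) (sm_targetM RR qc) (sm_target_smV RR qc)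
    (linpack lD) (sm_comul_smV RR qc) (sm_comul_target RR qc)
    sm_comul1 sm_comulA (sm_comul_ker RR qc)
    (linpack (@linear_sm_counit _ _ _ _ aL)) (@sm_counit_smV _ _ _ _ aL)
    sm_counit_target sm_counit1 sm_counit_l sm_counit_r sm_counit_ker.

End Bialgebroid.

(** * The antipode *)

Section InverseComul.
Variables (k : fieldType) (L H : algType k) (hL : hopf_algebra L).
Variables (hH : hopf_algebra H) (i : L -> H) (n : nat).
Variables (a : 'I_n -> L) (b : 'I_n -> H).
Hypothesis RR : left_R_matrix hL hH i a b.
Local Notation Δ := (comul hL).
Local Notation S := (antip hL).

(** The hexagon identity for the inverse [Q = (S ⊗ id) R] of [R], in which the
    factors come in the opposite order: both sides are inverse to [(Δ ⊗ id) R]. *)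
Lemma R_antip_comul (X : lmodType k) (F : L -> L -> H -> X) : trilin F ->
  \sum_j tlift (fun x y => F x y (b j)) (Δ (S (a j))) =
  \sum_j \sum_l F (S (a j)) (S (a l)) (b l * b j).
Proof.
move=> tF; pose A := ((L ⊗ L) ⊗ H)%type.
pose Y : A := \sum_j Δ (S (a j)) ⊗ b j.
pose D : A := \sum_j Δ (a j) ⊗ b j.
pose Z : A := \sum_j \sum_l (S (a j) ⊗ S (a l)) ⊗ (b l * b j).
have YD : Y * D = 1.
  have bF : bilin (fun (x : L) (y : H) => Δ x ⊗ y : A) by lin.
  rewrite -[RHS]/((1 : (L ⊗ L)%type) ⊗ (1 : H)) -[X in _ = X ⊗ _](rmorph1 Δ).
  rewrite -[RHS](R_antip_l RR bF) mulr_suml; apply: eq_bigr => j _; rewrite mulr_sumr.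
  by apply: eq_bigr => l _; rewrite tens_mulE rmorphM.
have DE : D = \sum_j \sum_l (a j ⊗ a l) ⊗ (b j * b l).
  have tG : trilin (fun (x y : L) (z : H) => (x ⊗ y) ⊗ z : A) by trilin.
  rewrite -(R_comul_l RR tG); apply: eq_bigr => j _.
  have lG : linear (fun z : (L ⊗ L)%type => z ⊗ b j : A) by lin.
  by rewrite (tlift_linear_tensor _ lG).
have DZ : D * Z = 1.
  have bF : bilin (fun (x : L) (y : H) => (x ⊗ (1 : L)) ⊗ y : A) by lin.
  rewrite -[RHS](R_antip_r RR bF) DE mulr_suml; apply: eq_bigr => j _.
  rewrite mulr_sumr; apply: eq_bigr => m _.
  have bG : bilin (fun (x : L) (y : H) => ((a j * S (a m)) ⊗ x) ⊗ (b j * y * b m) : A) by lin.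
  have := R_antip_r RR bG; rewrite mulr1 => <-.
  rewrite mulr_suml; apply: eq_bigr => l _; rewrite mulr_sumr.
  by apply: eq_bigr => p _; rewrite !tens_mulE !mulrA.
have YZ : Y = Z by rewrite -[Y]mulr1 -DZ mulrA YD mul1r.
have := congr1 (tlift3 F) YZ.
rewrite !(linear_sum_at _ _ (tlift3_linear tF)).
under eq_bigr do rewrite (tlift3E tF).
move=> ->; apply: eq_bigr => j _; rewrite (linear_sum_at _ _ (tlift3_linear tF)).
apply: eq_bigr => l _; rewrite (tlift3E tF) tliftE //.
by case: tF.
Qed.

End InverseComul.

Section Antipode.
Variables (k : fieldType) (L H V : algType k).
Variables (hL : hopf_algebra L) (hH : hopf_algebra H) (i : {lrmorphism L -> H}).
Variables (hi : hopf_morphism hL hH i) (aV : module_algebra hH V).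
Variables (n : nat) (a : 'I_n -> L) (b : 'I_n -> H).
Hypothesis RR : left_R_matrix hL hH i a b.
Local Notation aL := (restriction hi aV).
Hypothesis qc : forall v w : V,
  v * w = \sum_j act aV (b j) w * act aL (a j) v.
Variable Sinv : {linear L -> L}.
Local Notation T := (smash_product aL).
Local Notation Δ := (comul hL).
Local Notation ε := (counit hL).
Local Notation S := (antip hL).
Hypotheses (SK : cancel S Sinv) (SinvK : cancel Sinv S).
Local Notation "v # l" := (sm aL v l) (at level 30).
Local Notation α := (smV aL).
Local Notation ι := (smL aL).
Local Notation β := (sm_target hi aV a b).
Local Notation TV := (TT α β).
Local Notation π := (bproj (right_act β) (left_act α)).
Local Notation DT := (sm_comul (hi := hi) (aV := aV) a b).
Local Notation εT := (sm_counit (aV := aL)).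

Let SinvM x y : Sinv (x * y) = Sinv y * Sinv x.
Proof. by rewrite -{1}[x]SinvK -{1}[y]SinvK -antipM SK. Qed.

Lemma Sinv_r_lin (X : lmodType k) (G : L -> X) (lG : linear G) l :
  tlift (fun x y => G (y * Sinv x)) (Δ l) = (ε l : k) *: G 1.
Proof.
have lG' : linear (fun z => G (Sinv z)) by lin.
rewrite -[in RHS](SK 1) antip1 -(antip_r_lin hL lG').
by apply: eq_tlift => x y; rewrite SinvM SK.
Qed.

Lemma Sinv_l_lin (X : lmodType k) (G : L -> X) (lG : linear G) l :
  tlift (fun x y => G (Sinv y * x)) (Δ l) = (ε l : k) *: G 1.
Proof.
have lG' : linear (fun z => G (Sinv z)) by lin.
rewrite -[in RHS](SK 1) antip1 -(antip_l_lin hL lG').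
by apply: eq_tlift => x y; rewrite SinvM SK.
Qed.

(** Since [R] is invertible, the products [β v * ι l] represent the elements of
    the smash product as uniquely as the products [α v * ι l] do. *)
Definition sm_twist (s : T) : T := tlift (fun v l => β v * ι l) s.
Definition sm_untwist (s : T) : T :=
  tlift (fun v l => \sum_j act aV (b j) v # (S (a j) * l)) s.

Lemma sm_twistE v l : sm_twist (v # l) = β v * ι l.
Proof. by rewrite /sm_twist tliftE //; lin. Qed.

Lemma sm_untwistE v l :
  sm_untwist (v # l) = \sum_j act aV (b j) v # (S (a j) * l).
Proof. by rewrite /sm_untwist tliftE //; lin. Qed.

Lemma linear_sm_twist : linear sm_twist.
Proof. by rewrite /sm_twist; lin. Qed.

Lemma linear_sm_untwist : linear sm_untwist.
Proof. by rewrite /sm_untwist; lin. Qed.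

Lemma sm_twistK : cancel sm_twist sm_untwist.
Proof.
elim/sm_ind => [v l|x y Hx Hy]; last first.
  by rewrite (linearD_at _ _ linear_sm_twist) (linearD_at _ _ linear_sm_untwist) Hx Hy.
rewrite sm_twistE sm_target_smL (linear_sum_at _ _ linear_sm_untwist).
under eq_bigr do rewrite sm_untwistE.
have bF : bilin (fun x y => act aV y v # (x * l)) by lin.
rewrite -[v in RHS](act1 aV) -[l in RHS]mul1r -(R_antip_l RR bF) exchange_big.
by apply: eq_bigr => j _; apply: eq_bigr => m _; rewrite actM mulrA.
Qed.

Lemma sm_untwistK : cancel sm_untwist sm_twist.
Proof.
elim/sm_ind => [v l|x y Hx Hy]; last first.
  by rewrite (linearD_at _ _ linear_sm_untwist) (linearD_at _ _ linear_sm_twist) Hx Hy.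
rewrite sm_untwistE (linear_sum_at _ _ linear_sm_twist).
under eq_bigr do rewrite sm_twistE sm_target_smL.
have bF : bilin (fun x y => act aV y v # (x * l)) by lin.
rewrite -[v in RHS](act1 aV) -[l in RHS]mul1r -(R_antip_r RR bF) exchange_big.
by apply: eq_bigr => j _; apply: eq_bigr => m _; rewrite actM mulrA.
Qed.

(** The products [ι l * α v] represent the elements uniquely as well: the inverse
    antipode of [L] exchanges the order of the factors. *)
Definition sm_flip (s : T) : T := tlift (fun v l => ι (S l) * α v) s.
Definition sm_unflip (s : T) : T :=
  tlift (fun v l => tlift (fun x y => act aL (Sinv x) v # Sinv y) (Δ l)) s.

Lemma sm_flipE v l : sm_flip (v # l) = ι (S l) * α v.
Proof. by rewrite /sm_flip tliftE //; lin. Qed.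

Lemma sm_unflipE v l :
  sm_unflip (v # l) = tlift (fun x y => act aL (Sinv x) v # Sinv y) (Δ l).
Proof. by rewrite /sm_unflip tliftE //; lin. Qed.

Lemma linear_sm_flip : linear sm_flip.
Proof. by rewrite /sm_flip; lin. Qed.

Lemma linear_sm_unflip : linear sm_unflip.
Proof. by rewrite /sm_unflip; lin. Qed.

Lemma sm_unflipK : cancel sm_unflip sm_flip.
Proof.
elim/sm_ind => [v l|x y Hx Hy]; last first.
  by rewrite (linearD_at _ _ linear_sm_unflip) (linearD_at _ _ linear_sm_flip) Hx Hy.
rewrite sm_unflipE (linear_tlift _ _ linear_sm_flip).
transitivity (tlift (fun x y => tlift (fun p q => act aL (p * Sinv x) v # q) (Δ y)) (Δ l)).
  apply: eq_tlift => x y; rewrite sm_flipE SinvK smL_smV.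
  by apply: eq_tlift => p q; rewrite actM.
rewrite -tlift_coassoc; [|lin..].
rewrite -(counit_l_lin hL (linear_smr aL v)); apply: eq_tlift => x y.
have lG : linear (fun z => act aL z v # y) by lin.
by rewrite (Sinv_r_lin lG) act1.
Qed.

Lemma sm_flipK : cancel sm_flip sm_unflip.
Proof.
elim/sm_ind => [v l|x y Hx Hy]; last first.
  by rewrite (linearD_at _ _ linear_sm_flip) (linearD_at _ _ linear_sm_unflip) Hx Hy.
rewrite sm_flipE smL_smV (linear_tlift _ _ linear_sm_unflip).
transitivity (tlift (fun x y => tlift (fun p q => act aL (Sinv p * x) v # Sinv q) (Δ y)) (Δ (S l))).
  apply: eq_tlift => x y; rewrite sm_unflipE.
  by apply: eq_tlift => p q; rewrite actM.
rewrite -tlift_coassoc; [|lin..].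
have lG : linear (fun z => v # Sinv z) by lin.
rewrite -[in RHS](SK l) -(counit_l_lin hL lG); apply: eq_tlift => x y.
have lG' : linear (fun z => act aL z v # Sinv y) by lin.
by rewrite (Sinv_l_lin lG') act1.
Qed.

(** The map [β v * ι l |-> ι (S l) * α v], the only possible anti-multiplicative
    one that extends the antipode of [L] and sends [β] to [α]. *)
Definition sm_antip (s : T) : T := sm_flip (sm_untwist s).

Lemma sm_antip_linear : linear sm_antip.
Proof. by move=> c x y; rewrite /sm_antip linear_sm_untwist linear_sm_flip. Qed.

Lemma sm_antip_twist v l : sm_antip (β v * ι l) = ι (S l) * α v.
Proof. by rewrite -sm_twistE /sm_antip sm_twistK sm_flipE. Qed.

Lemma sm_antip_bij : bijective sm_antip.
Proof.
exists (fun s => sm_twist (sm_unflip s)) => s.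
  by rewrite /sm_antip sm_flipK sm_untwistK.
by rewrite /sm_antip sm_twistK sm_unflipK.
Qed.

Lemma sm_antip_target v : sm_antip (β v) = α v.
Proof.
by have := sm_antip_twist v 1; rewrite antip1 smL1 mulr1 mul1r.
Qed.

Lemma sm_antip_smL l : sm_antip (ι l) = ι (S l).
Proof.
by have := sm_antip_twist 1 l; rewrite (sm_target1 hi aV RR) smV1 mulr1 mul1r.
Qed.

Lemma sm_antip1 : sm_antip 1 = 1.
Proof. by rewrite -(smL1 aL) sm_antip_smL antip1. Qed.

(** Both factors are written as products [β v * ι l]. Reordering the product
    inside by [smL_target] and outside by [smL_antip_act] gives the same sum. *)
Lemma sm_antipM s t : sm_antip (s * t) = sm_antip t * sm_antip s.
Proof.
rewrite -[s]sm_untwistK -[t]sm_untwistK.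
elim/sm_ind: (sm_untwist s) => [v l|x y Hx Hy]; last first.
  rewrite (linearD_at _ _ linear_sm_twist) mulrDl !(linearD_at _ _ sm_antip_linear).
  by rewrite Hx Hy mulrDr.
elim/sm_ind: (sm_untwist t) => [w m|x y Hx Hy]; last first.
  rewrite (linearD_at _ _ linear_sm_twist) mulrDr !(linearD_at _ _ sm_antip_linear).
  by rewrite Hx Hy mulrDl.
rewrite !sm_twistE !sm_antip_twist.
transitivity (sm_antip (tlift (fun x y => β (act aL y w * v) * ι (x * m)) (Δ l))).
  congr (sm_antip _); rewrite -mulrA (mulrA (ι l)) (smL_target hi aV RR).
  rewrite tlift_mull tlift_mulr; apply: eq_tlift => x y.
  by rewrite (sm_targetM RR qc) smLM !mulrA.
rewrite (linear_tlift _ _ sm_antip_linear).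
transitivity (ι (S m) * (α w * ι (S l)) * α v); last by rewrite !mulrA.
rewrite -smL_antip_act tlift_mulr tlift_mull; apply: eq_tlift => x y.
by rewrite sm_antip_twist antipM smLM smVM !mulrA.
Qed.

Lemma sm_counit_target1 w : εT (β w) = w.
Proof.
have := sm_counit_target qc w 1.
by rewrite mulr1 (sm_counit1 hi aV) mul1r.
Qed.

Lemma sm_antip_smV v :
  sm_antip (α v) = \sum_j ι (S (S (a j))) * α (act aV (b j) v).
Proof.
rewrite /sm_antip sm_untwistE (linear_sum_at _ _ linear_sm_flip).
by apply: eq_bigr => j _; rewrite sm_flipE mulr1.
Qed.

(** The right hand side lets [S (S (a j))] act under [β], which is conjugation by
    the coproduct of [S (a j)] ([target_act_antip]). This coproduct is known from
    [R_antip_comul], and one half of it undoes the passage from [α] to [β]. *)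
Lemma sm_antip_smV_target v : sm_antip (α v) = β (εT (sm_antip (α v))).
Proof.
rewrite {2}sm_antip_smV (linear_sum_at _ _ (@linear_sm_counit _ _ _ _ aL)).
rewrite (linear_sum_at _ _ (linear_sm_target hi aV a b)).
pose F x y z := ι (S x) * β (act aV z v) * ι y.
have tF : trilin F by rewrite /F; trilin.
transitivity (\sum_j tlift (fun x y => F x y (b j)) (Δ (S (a j)))); last first.
  apply: eq_bigr => j _; rewrite sm_counitM.
  have -> : εT (α (act aV (b j) v)) = act aV (b j) v.
    by rewrite sm_counitE rmorph1 scale1r.
  by rewrite sm_actE mul1r (target_act_antip hi aV RR).
rewrite (R_antip_comul RR tF) sm_antip_smV; apply: eq_bigr => j _.
rewrite /F; under eq_bigr do rewrite -mulrA.
rewrite -mulr_sumr; congr (_ * _).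
rewrite -[LHS](sm_untwistK (act aV (b j) v # 1)) sm_untwistE.
rewrite (linear_sum_at _ _ linear_sm_twist).
by apply: eq_bigr => l _; rewrite sm_twistE mulr1 actM.
Qed.

(** With [w] such that [sm_antip (α v) = β w], both sides are [β (S l w)] at
    [v # l]. *)
Lemma sm_antip_l s :
  blift (fun x y => sm_antip x * y) (DT s : TV) = β (εT (sm_antip s)).
Proof.
have lS := sm_antip_linear.
have lε := @linear_sm_counit _ _ _ _ aL.
have bf : bilin (fun x y => sm_antip x * y) by lin.
rewrite /sm_comul /lift_comul blift_bproj //; last first.
  by move=> c x y; rewrite /right_act sm_antipM sm_antip_target -mulrA.
elim/sm_ind: s => [v l|x y Hx Hy]; last first.
  rewrite (linearD_at _ _ (@linear_sm_cop _ _ _ _ _)) tliftD // Hx Hy.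
  by rewrite (linearD_at _ _ lS) (linearD_at _ _ lε)
    (linearD_at _ _ (linear_sm_target _ _ _ _)).
have E m : sm_antip (v # m) = ι (S m) * β (εT (sm_antip (α v))).
  by rewrite smE sm_antipM sm_antip_smL {1}sm_antip_smV_target.
rewrite E sm_counitM sm_counit_target1 sm_actE mul1r (target_act_antip hi aV RR).
rewrite sm_copE tlift_tlift //; apply: eq_tlift => x y.
by rewrite tliftE // E.
Qed.

(** Balanced tensors have unique representatives in the subspace [T ⊗ ι L]: the
    part of the second factor in [V] can be moved to the first one as a target. *)
Definition sm_repr (t s : T) : (T ⊗ T)%type :=
  tlift (fun v l => (β v * t) ⊗ ι l) s.

Lemma sm_reprE t v l : sm_repr t (v # l) = (β v * t) ⊗ ι l.
Proof. by rewrite /sm_repr tliftE //; lin. Qed.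

Lemma sm_repr_bilin : bilin sm_repr.
Proof. by rewrite /sm_repr; lin. Qed.

Lemma sm_repr_bal : balanced (right_act β) (left_act α) sm_repr.
Proof.
move=> c t s; elim/sm_ind: s => [v l|x y Hx Hy]; last first.
  rewrite /left_act mulrDr !(bilinDr _ _ _ sm_repr_bilin).
  by rewrite -/(left_act α c x) -/(left_act α c y) Hx Hy.
by rewrite /left_act /right_act smV_sm !sm_reprE (sm_targetM RR qc) mulrA.
Qed.

Lemma sm_antip_r :
  exists2 gamma : {linear TV -> (T ⊗ T)%type},
    (forall x, bproj _ _ (gamma x) = x) &
    (forall s, tlift (fun x y => x * sm_antip y) (gamma (DT s)) = α (εT s)).
Proof.
exists (linpack (linear_blift sm_repr_bilin sm_repr_bal)) => [x|s] /=.
  have [z ->] := bproj_surj x.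
  rewrite (blift_bproj sm_repr_bilin sm_repr_bal).
  have lp : linear π by exact: bproj_linear.
  rewrite (linear_tlift _ _ lp) -[RHS](tlift_linear_tensor _ lp).
  apply: eq_tlift => t s; elim/sm_ind: s => [v l|s s' Hs Hs']; last first.
    rewrite (bilinDr _ _ _ sm_repr_bilin) tensDr !(linearD_at _ _ lp).
    exact: (congr2 +%R Hs Hs').
  by rewrite sm_reprE smE; exact: TT_bal.
have lS := sm_antip_linear.
have lε := @linear_sm_counit _ _ _ _ aL.
have bf : bilin (fun x y => x * sm_antip y) by lin.
rewrite (blift_bproj sm_repr_bilin sm_repr_bal).
rewrite (tlift_tlift _ _ bf).
have bg : bilin (fun u v => tlift (fun x y => x * sm_antip y) (sm_repr u v)).
  split=> [v|u]; first exact: (linear_tlift_arg bf (sm_repr_bilin.1 v)).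
  exact: (linear_tlift_arg bf (sm_repr_bilin.2 u)).
elim/sm_ind: s => [v l|x y Hx Hy]; last first.
  rewrite (linearD_at _ _ (@linear_sm_cop _ _ _ _ _)) (tliftD _ _ bg) Hx Hy.
  by rewrite (linearD_at _ _ lε) (linearD_at _ _ (linear_smV _)).
rewrite sm_copE (tlift_tlift _ _ bg) sm_counitE (linearZ_at _ _ (linear_smV _)).
rewrite -(antip_r_lin hL (linear_smr aL v)); apply: eq_tlift => x y.
rewrite (tliftE _ _ bg) sm_reprE (tliftE _ _ bf) (sm_target1 hi aV RR) mul1r.
by rewrite sm_antip_smL sm_smL.
Qed.

Definition smash_hopf_algebroid : hopf_algebroid V T :=
  @HopfAlgebroid k V T (smash_bialgebroid RR qc) (linpack sm_antip_linear)
    sm_antip1 sm_antipM sm_antip_bij sm_antip_target sm_antip_l sm_antip_r.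

End Antipode.

(** * Hopf subalgebras *)

Section TensorMaps.
Variable k : fieldType.
Implicit Types U V W X Y Z : lmodType k.

Lemma linear_tmap U V W X (f : U -> W) (g : V -> X) :
  linear f -> linear g -> linear (tmap f g).
Proof. by move=> lf lg; exact/tlift_linear/bilin_tens. Qed.

Lemma tmapE U V W X (f : U -> W) (g : V -> X) u v :
  linear f -> linear g -> tmap f g (u ⊗ v) = f u ⊗ g v.
Proof. by move=> lf lg; exact/tliftE/bilin_tens. Qed.

Lemma tlift_tmap U V W X Y (f : U -> W) (g : V -> X) (h : W -> X -> Y) (x : (U ⊗ V)%type) :
  bilin h -> tlift h (tmap f g x) = tlift (fun u v => h (f u) (g v)) x.
Proof.
move=> bh; rewrite /tmap tlift_tlift //; apply: eq_tlift => u v.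
exact: tliftE.
Qed.

Lemma tmap_comp U V W X Y Z (f : U -> W) (g : V -> X) (f' : W -> Y) (g' : X -> Z) x :
  linear f' -> linear g' ->
  tmap f' g' (tmap f g x) = tmap (fun u => f' (f u)) (fun v => g' (g v)) x.
Proof. by move=> lf lg; rewrite {1}/tmap tlift_tmap //; exact: bilin_tens. Qed.

Lemma tmap_id U V (f : U -> U) (g : V -> V) x : f =1 id -> g =1 id -> tmap f g x = x.
Proof.
move=> fE gE; have l : linear (@id (U ⊗ V)%type) by [].
by rewrite -[RHS](tlift_linear_tensor _ l); apply: eq_tlift => u v; rewrite fE gE.
Qed.

Lemma eq_tmap U V W X (f f' : U -> W) (g g' : V -> X) :
  f =1 f' -> g =1 g' -> tmap f g =1 tmap f' g'.
Proof. by move=> fE gE x; apply: eq_tlift => u v; rewrite fE gE. Qed.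

Lemma tmapM (A B A' B' : algType k) (f : {lrmorphism A -> A'}) (g : {lrmorphism B -> B'}) :
  {morph tmap f g : x y / x * y}.
Proof.
have lt : linear (tmap f g) by apply: linear_tmap; exact: linearP.
move=> x y; elim/tens_ind: x => [a b|x x' Hx Hx']; last first.
  by rewrite mulrDl !(linearD_at _ _ lt) Hx Hx' mulrDl.
elim/tens_ind: y => [c d|y y' Hy Hy']; last first.
  by rewrite mulrDr !(linearD_at _ _ lt) Hy Hy' mulrDr.
by rewrite tens_mulE !tmapE ?tens_mulE ?rmorphM //; exact: linearP.
Qed.

Lemma linear_tassoc U V W : linear (@tassoc k U V W).
Proof. by apply: tlift_linear; lin. Qed.

Lemma tassocE U V W (u : U) (v : V) (w : W) : tassoc (u ⊗ (v ⊗ w)) = (u ⊗ v) ⊗ w.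
Proof. by rewrite /tassoc tliftE ?tliftE //; lin. Qed.

Lemma tassoc_tmap U V W (U' V' W' : lmodType k) (f : U -> U') (g : V -> V') (h : W -> W') x :
  linear f -> linear g -> linear h ->
  tassoc (tmap f (tmap g h) x) = tmap (tmap f g) h (tassoc x).
Proof.
move=> lf lg lh; have lfg := linear_tmap lf lg; have lgh := linear_tmap lg lh.
have l1 := linear_tmap lf lgh; have l2 := linear_tmap lfg lh.
have ass X1 X2 X3 := @linear_tassoc X1 X2 X3.
elim/tens_ind: x => [u z|x y Hx Hy]; last first.
  by rewrite (linearD_at _ _ l1) !(linearD_at _ _ (ass _ _ _)) Hx Hy (linearD_at _ _ l2).
elim/tens_ind: z => [v w|x y Hx Hy]; last first.
  by rewrite tensDr (linearD_at _ _ l1) !(linearD_at _ _ (ass _ _ _)) Hx Hy (linearD_at _ _ l2).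
by rewrite !tmapE // !tassocE !tmapE.
Qed.

End TensorMaps.

(** A subalgebra with a linear retraction is a Hopf subalgebra as soon as the
    coproduct and the antipode stay inside of it: the structure maps are the
    retractions of those of [H], and the axioms hold since the inclusion and
    its tensor powers are injective. *)
Section SubHopf.
Variables (k : fieldType) (H L : algType k) (hH : hopf_algebra H).
Variables (inc : {lrmorphism L -> H}) (ret : {linear H -> L}).
Hypothesis incK : cancel inc ret.
Local Notation Δ := (comul hH).
Hypothesis comul_in : forall l, tmap inc inc (tmap ret ret (Δ (inc l))) = Δ (inc l).
Hypothesis antip_in : forall l, inc (ret (antip hH (inc l))) = antip hH (inc l).

Let li : linear inc. Proof. exact: linearP. Qed.
Let lr : linear ret. Proof. exact: linearP. Qed.
Let inj_inc : injective inc. Proof. exact: can_inj incK. Qed.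
Let lii : linear (tmap inc inc). Proof. exact: linear_tmap. Qed.

Let incincK : cancel (tmap inc inc) (tmap ret ret).
Proof. by move=> x; rewrite tmap_comp // tmap_id // => u; exact: incK. Qed.

Definition sub_comul (l : L) : (L ⊗ L)%type := tmap ret ret (Δ (inc l)).
Definition sub_counit (l : L) : k^o := counit hH (inc l).
Definition sub_antip (l : L) : L := ret (antip hH (inc l)).

Lemma sub_comul_inc l : tmap inc inc (sub_comul l) = Δ (inc l).
Proof. exact: comul_in. Qed.

Lemma sub_comul_linear : linear sub_comul.
Proof.
have lrr := linear_tmap lr lr.
by move=> c x y; rewrite /sub_comul linearP linearP lrr.
Qed.

Lemma sub_comul_monoid : monoid_morphism sub_comul.
Proof.
split; first by rewrite /sub_comul !rmorph1 tmapE // -(rmorph1 inc) !incK.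
move=> x y; apply: (can_inj incincK).
by rewrite tmapM !sub_comul_inc !rmorphM.
Qed.

Lemma sub_counit_linear : linear sub_counit.
Proof. by move=> c x y; rewrite /sub_counit !linearP. Qed.

Lemma sub_counit_monoid : monoid_morphism sub_counit.
Proof. by rewrite /sub_counit; split=> [|x y]; rewrite ?rmorph1 ?rmorphM. Qed.

Lemma sub_antip_linear : linear sub_antip.
Proof. by move=> c x y; rewrite /sub_antip !linearP. Qed.

HB.instance Definition _ := GRing.isLinear.Build k L _ _ sub_comul sub_comul_linear.
HB.instance Definition _ := GRing.isMonoidMorphism.Build L (L ⊗ L)%type sub_comul sub_comul_monoid.
HB.instance Definition _ := GRing.isLinear.Build k L k^o _ sub_counit sub_counit_linear.
HB.instance Definition _ := GRing.isMonoidMorphism.Build L k^o sub_counit sub_counit_monoid.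
HB.instance Definition _ := GRing.isLinear.Build k L L _ sub_antip sub_antip_linear.

Lemma sub_comulA l :
  tmap sub_comul id (sub_comul l) = tassoc (tmap id sub_comul (sub_comul l)).
Proof.
have lc : linear sub_comul by exact: sub_comul_linear.
have lid : linear (@id L) by [].
have lidH : linear (@id H) by [].
have lD : linear Δ by exact: linearP.
have inj3 : injective (tmap (tmap inc inc) inc).
  apply: (@can_inj _ _ _ (tmap (tmap ret ret) ret)) => x.
  by rewrite tmap_comp //; [rewrite tmap_id //|exact: linear_tmap].
apply: inj3; rewrite -tassoc_tmap // [LHS](tmap_comp sub_comul id _ lii li).
rewrite [in RHS](tmap_comp id sub_comul _ li lii).
transitivity (tmap Δ id (tmap inc inc (sub_comul l))).
  by rewrite (tmap_comp inc inc _ lD lidH); apply: eq_tmap => // u; exact: sub_comul_inc.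
rewrite sub_comul_inc comulA -sub_comul_inc (tmap_comp inc inc _ lidH lD).
by congr tassoc; apply: eq_tmap => // u; exact/esym/sub_comul_inc.
Qed.

Lemma sub_tlift (f : H -> H -> H) (g : L -> L -> L) l :
  bilin f -> (forall x y, inc (g x y) = f (inc x) (inc y)) ->
  inc (tlift g (sub_comul l)) = tlift f (Δ (inc l)).
Proof.
move=> bf fg; rewrite (linear_tlift _ _ li) -sub_comul_inc tlift_tmap //.
by apply: eq_tlift => x y; rewrite fg.
Qed.

Lemma sub_counit_l l : tlift (fun x y => (sub_counit x : k) *: y) (sub_comul l) = l.
Proof.
apply: inj_inc; rewrite -[RHS](counit_l hH); apply: sub_tlift; first by lin.
by move=> x y; rewrite linearZ.
Qed.

Lemma sub_counit_r l : tlift (fun x y => (sub_counit y : k) *: x) (sub_comul l) = l.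
Proof.
apply: inj_inc; rewrite -[RHS](counit_r hH); apply: sub_tlift; first by lin.
by move=> x y; rewrite linearZ.
Qed.

Lemma sub_antip_l l :
  tlift (fun x y => sub_antip x * y) (sub_comul l) = (sub_counit l : k)%:A.
Proof.
apply: inj_inc; rewrite linearZ rmorph1 -[RHS](antip_l hH).
apply: sub_tlift; first by lin.
by move=> x y; rewrite [LHS]rmorphM; congr (_ * _); exact: antip_in.
Qed.

Lemma sub_antip_r l :
  tlift (fun x y => x * sub_antip y) (sub_comul l) = (sub_counit l : k)%:A.
Proof.
apply: inj_inc; rewrite linearZ rmorph1 -[RHS](antip_r hH).
apply: sub_tlift; first by lin.
by move=> x y; rewrite [LHS]rmorphM; congr (_ * _); exact: antip_in.
Qed.

Definition sub_hopf : hopf_algebra L :=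
  HopfAlgebra sub_comulA sub_counit_l sub_counit_r sub_antip_l sub_antip_r.

Lemma sub_hopf_morphism : hopf_morphism sub_hopf hH inc.
Proof. by split=> l //; [exact/esym/sub_comul_inc | exact/esym/antip_in]. Qed.

End SubHopf.

Section SubAlgebraType.
Variables (k : fieldType) (H : algType k) (P : H -> Prop).

Definition subalgebra : Prop := subalg_closed (fun x => `[< P x >]).
(** The proof of closure is an argument, so that the algebra structure can be
    inferred from the type. *)
Definition subalg_pred (hP : subalgebra) : {pred H} := fun x => `[< P x >].

Variable hP : subalgebra.
HB.instance Definition _ := GRing.isSubalgClosed.Build k H (subalg_pred hP) (GRing.subalg_closed_semi hP).

Record subalg_type := SubAlg { subalg_val : H; _ : subalg_val \in subalg_pred hP }.
HB.instance Definition _ := [isSub for subalg_val].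
HB.instance Definition _ := [Choice of subalg_type by <:].
HB.instance Definition _ := [SubChoice_isSubAlgebra of subalg_type by <:].

Lemma subalg_val_linear : linear subalg_val.
Proof. by []. Qed.

Lemma subalg_val_monoid : monoid_morphism subalg_val.
Proof. by []. Qed.

HB.instance Definition _ :=
  GRing.isLinear.Build k subalg_type H _ subalg_val subalg_val_linear.
HB.instance Definition _ :=
  GRing.isMonoidMorphism.Build subalg_type H subalg_val subalg_val_monoid.

End SubAlgebraType.

(** * The left leg of the universal R-matrix *)

Section LeftLeg.
Variables (k : fieldType) (H : algType k) (hH : hopf_algebra H) (n : nat).
Variables (a b : 'I_n -> H) (q p : 'I_n -> {linear H -> k^o}).
Local Notation Δ := (comul hH).
Local Notation ε := (counit hH).
Local Notation S := (antip hH).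
Local Notation R := (\sum_j a j ⊗ b j).
Hypothesis qtR : quasitriangular hH R.
Hypothesis qa : forall i j, q j (a i) = (i == j)%:R.
Hypothesis pb : forall i j, p j (b i) = (i == j)%:R.

Let RR : left_R_matrix hH hH id a b := qt_left_R_matrix qtR.

Lemma sum_delta (X : lmodType k) (f : 'I_n -> X) m :
  \sum_j ((j == m)%:R : k) *: f j = f m.
Proof.
rewrite (bigD1 m) //= eqxx scale1r big1 ?addr0 // => j /negPf->.
by rewrite scale0r.
Qed.

Lemma Rl_sum (c : 'I_n -> k) : Rl R (\sum_j c j *: a j).
Proof.
have lf : scalar (fun y => \sum_j c j * p j y).
  move=> e x y; rewrite mulr_sumr -big_split; apply: eq_bigr => j _ /=.
  by rewrite linearP mulrDr mulrCA.
exists (scalarpack lf); rewrite tlift_sumE /=; last first.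
  split=> [y|x] e u v /=; last by rewrite lf scalerDl scalerA.
  by rewrite scalerDr !scalerA mulrC.
apply: eq_bigr => j _; rewrite (bigD1 j) //= pb eqxx mulr1 big1 ?addr0 // => m mj.
by rewrite pb eq_sym (negPf mj) mulr0.
Qed.

Lemma RlE x : Rl R x -> exists c : 'I_n -> k, x = \sum_j c j *: a j.
Proof.
case=> f ->; exists (fun j => f (b j)); rewrite tlift_sumE //.
split=> [y|u] e x' y' /=; last by rewrite linearP scalerDl scalerA.
by rewrite scalerDr !scalerA mulrC.
Qed.

Definition Rl_proj (x : H) : H := \sum_j (q j x : k) *: a j.

Lemma Rl_proj_linear : linear Rl_proj.
Proof. by rewrite /Rl_proj; lin. Qed.

Lemma Rl_proj_a m : Rl_proj (a m) = a m.
Proof.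
rewrite /Rl_proj; under eq_bigr do rewrite qa eq_sym.
exact: sum_delta.
Qed.

(** Linear identities on the left leg need only be checked on the [a j]. *)
Lemma Rl_ext (X : lmodType k) (f g : H -> X) : linear f -> linear g ->
  (forall j, f (a j) = g (a j)) -> forall x, Rl R x -> f x = g x.
Proof.
move=> lf lg E x /RlE[c ->]; rewrite !linear_sum_at //.
by apply: eq_bigr => j _; rewrite !linearZ_at // E.
Qed.

Lemma Rl_projE x : Rl R x -> Rl_proj x = x.
Proof. exact: (Rl_ext Rl_proj_linear (fun _ _ _ => erefl) Rl_proj_a). Qed.

Lemma Rl_proj_in x : Rl R (Rl_proj x).
Proof. exact: Rl_sum. Qed.

Lemma Rl_linear c x y : Rl R x -> Rl R y -> Rl R (c *: x + y).
Proof.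
by move=> /Rl_projE <- /Rl_projE <-; rewrite -Rl_proj_linear; exact: Rl_proj_in.
Qed.

(** The second hexagon identity turns the product of the elements defined by two
    functionals into the element defined by their convolution. *)
Lemma Rl_mul x y : Rl R x -> Rl R y -> Rl R (x * y).
Proof.
move=> [f ->] [g ->].
have lf (h : {scalar H}) : linear (h : H -> k^o) by move=> e x' y'; exact: linearP.
pose f' := linpack (lf f); pose g' := linpack (lf g).
have bf (h : {linear H -> k^o}) : bilin (fun x y : H => (h y : k) *: x) by lin.
pose F (x y z : H) := (f' z : k) *: ((g' y : k) *: x).
have tF : trilin F by rewrite /F; trilin.
have -> : tlift (fun a b => (f' b : k) *: a) R * tlift (fun a b => (g' b : k) *: a) R =
    \sum_j tlift (F (a j)) (Δ (b j)).
  rewrite (R_comul_r RR tF) !tlift_sumE // mulr_suml; apply: eq_bigr => j _.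
  by rewrite mulr_sumr; apply: eq_bigr => l _; rewrite -scalerAl -scalerAr.
have -> : \sum_j tlift (F (a j)) (Δ (b j)) =
    \sum_j (tlift (fun y z => (f' z * g' y : k^o)) (Δ (b j)) : k) *: a j.
  apply: eq_bigr => j _; rewrite /F.
  have lG : linear (fun z : k^o => (z : k) *: a j) by lin.
  rewrite (linear_tlift _ _ lG); apply: eq_tlift => u v.
  by rewrite scalerA.
exact: Rl_sum.
Qed.

Lemma Rl_subalgebra : subalgebra (Rl R).
Proof.
split=> [|c x y /asboolP Rx /asboolP Ry|x y /asboolP Rx /asboolP Ry]; apply/asboolP.
- by rewrite -(R_counit_r RR); exact: Rl_sum.
- exact: Rl_linear.
- exact: Rl_mul.
Qed.

(** By the first hexagon identity, [Δ (a m)] is the sum of the [a j ⊗ a l] with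
    coefficients [p m (b j * b l)]. *)
Lemma Rl_comul x : Rl R x -> tmap Rl_proj Rl_proj (Δ x) = Δ x.
Proof.
have lt := linear_tmap Rl_proj_linear Rl_proj_linear.
apply: (Rl_ext (f := fun x => tmap Rl_proj Rl_proj (Δ x)) (g := Δ)).
- exact: (linear_compose lt (linearP Δ)).
- exact: linearP.
move=> m; pose F x y z := (p m z : k) *: (x ⊗ y : (H ⊗ H)%type).
have tF : trilin F by rewrite /F; trilin.
have -> : Δ (a m) = \sum_j \sum_l F (a j) (a l) (b j * b l).
  rewrite -(R_comul_l RR tF) -(sum_delta (fun j => Δ (a j)) m).
  apply: eq_bigr => j _; rewrite /F pb.
  have lG : linear (fun z : (H ⊗ H)%type => ((j == m)%:R : k) *: z) by lin.
  by rewrite (tlift_linear_tensor _ lG).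
rewrite (linear_sum_at _ _ lt); apply: eq_bigr => j _.
rewrite (linear_sum_at _ _ lt); apply: eq_bigr => l _.
rewrite /F (linearZ_at _ _ lt) tmapE ?Rl_proj_a //; exact: Rl_proj_linear.
Qed.

(** Since [R = (S ⊗ S) R], each [a j] is a combination of the [S (a l)]. The
    matrix of this change of families is square, hence invertible, so that [S]
    maps the left leg onto itself. *)
Let M : 'M[k]_n := \matrix_(j, l) p j (S (b l)).
Let N : 'M[k]_n := \matrix_(j, l) q l (S (a j)).

Let a_antip j : a j = \sum_l M j l *: S (a l).
Proof.
have bf : bilin (fun x y => (p j y : k) *: x : H) by lin.
have := congr1 (tlift (fun x y => (p j y : k) *: x)) (qt_antip_antip qtR).
rewrite !tlift_sumE //; under eq_bigr do rewrite pb.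
by rewrite sum_delta => ->; apply: eq_bigr => l _; rewrite mxE.
Qed.

Let NM : N *m M = 1%:M.
Proof.
apply: mulmx1C; apply/matrixP => j l; rewrite !mxE -qa.
rewrite [in RHS](a_antip j) (linear_sum_at _ _ (linearP (q l))).
by apply: eq_bigr => m _; rewrite (linearZ_at _ _ (linearP (q l))) !mxE.
Qed.

Let antip_a m : S (a m) = \sum_j N m j *: a j.
Proof.
rewrite -[LHS](sum_delta (fun l => S (a l)) m).
under [RHS]eq_bigr do rewrite a_antip scaler_sumr.
rewrite exchange_big; apply: eq_bigr => l _.
under [RHS]eq_bigr do rewrite scalerA.
rewrite -scaler_suml; congr (_ *: _).
have /matrixP/(_ m l) := NM; rewrite !mxE eq_sym => <-.
by apply: eq_bigr => j _; rewrite !mxE.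
Qed.

Lemma Rl_antip x : Rl R x -> Rl R (S x).
Proof.
move=> Rx; suff <- : Rl_proj (S x) = S x by exact: Rl_proj_in.
apply: (Rl_ext (f := fun x => Rl_proj (S x)) (g := S)) Rx.
- exact: (linear_compose Rl_proj_linear (linearP S)).
- exact: linearP.
by move=> j; apply: Rl_projE; rewrite antip_a; exact: Rl_sum.
Qed.

(** On the left leg, where [M] is the matrix of [S^-1]. *)
Definition Rl_antip_inv (x : H) : H := \sum_j (q j x : k) *: \sum_l M j l *: a l.

Lemma Rl_antip_inv_linear : linear Rl_antip_inv.
Proof. by rewrite /Rl_antip_inv; lin. Qed.

Lemma Rl_antip_inv_a m : Rl_antip_inv (a m) = \sum_l M m l *: a l.
Proof.
rewrite /Rl_antip_inv; under eq_bigr do rewrite qa eq_sym.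
exact: sum_delta.
Qed.

Lemma Rl_antip_inv_in x : Rl R (Rl_antip_inv x).
Proof.
have -> : Rl_antip_inv x = \sum_l (\sum_j q j x * M j l : k) *: a l.
  rewrite /Rl_antip_inv; under eq_bigr do rewrite scaler_sumr.
  rewrite exchange_big; apply: eq_bigr => l _; rewrite scaler_suml.
  by apply: eq_bigr => j _; rewrite scalerA.
exact: Rl_sum.
Qed.

Lemma Rl_antip_invK x : Rl R x -> S (Rl_antip_inv x) = x.
Proof.
apply: (Rl_ext (f := fun x => S (Rl_antip_inv x)) (g := id)) => //.
  exact: (linear_compose (linearP S) Rl_antip_inv_linear).
move=> j; rewrite Rl_antip_inv_a (linear_sum_at _ _ (linearP S)) [RHS]a_antip.
by apply: eq_bigr => l _; rewrite (linearZ_at _ _ (linearP S)).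
Qed.

Lemma Rl_antipK x : Rl R x -> Rl_antip_inv (S x) = x.
Proof.
apply: (Rl_ext (f := fun x => Rl_antip_inv (S x)) (g := id)) => //.
  exact: (linear_compose Rl_antip_inv_linear (linearP S)).
move=> m; rewrite antip_a (linear_sum_at _ _ Rl_antip_inv_linear).
rewrite -[RHS](sum_delta a m).
under eq_bigr do rewrite (linearZ_at _ _ Rl_antip_inv_linear) Rl_antip_inv_a scaler_sumr.
rewrite exchange_big; apply: eq_bigr => l _.
under eq_bigr do rewrite scalerA.
rewrite -scaler_suml; congr (_ *: _).
have /matrixP/(_ m l) := NM; rewrite !mxE eq_sym => <-.
by apply: eq_bigr => j _; rewrite !mxE.
Qed.

Section Existence.
Let L := subalg_type Rl_subalgebra.
Let inc : {lrmorphism subalg_type Rl_subalgebra -> H} := @subalg_val _ _ _ Rl_subalgebra.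

Let ret (x : H) : L := @SubAlg _ _ _ Rl_subalgebra (Rl_proj x) (asboolT (Rl_proj_in x)).

Let ret_linear : linear ret.
Proof.
move=> c x y; apply: val_inj; rewrite linearP /=.
exact: Rl_proj_linear.
Qed.

Let in_Rl (l : L) : Rl R (inc l).
Proof. by case: l => x Px; exact/asboolP/Px. Qed.

Lemma Rl_hopf_subalgebra : inhabited (hopf_subalgebra hH (Rl R)).
Proof.
have incK : cancel inc (linpack ret_linear).
  by move=> l; apply: val_inj; exact: Rl_projE (in_Rl l).
have comul_in l : tmap inc inc (tmap ret ret (Δ (inc l))) = Δ (inc l).
  rewrite tmap_comp; [|exact: linearP..].
  exact: (Rl_comul (in_Rl l)).
have antip_in l : inc (ret (S (inc l))) = S (inc l).
  exact: (Rl_projE (Rl_antip (in_Rl l))).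
constructor; apply: (HopfSubalgebra (sub_hopf_morphism incK comul_in antip_in)).
  exact: val_inj.
move=> x; split=> [Rx|[l ->]]; last exact: in_Rl.
by exists (ret x); rewrite -[LHS](Rl_projE Rx).
Qed.

End Existence.

(** Every Hopf subalgebra supported on the left leg inherits the R-matrix, by
    the retraction of [H] onto the left leg. *)
Section Transfer.
Variable L : hopf_subalgebra hH (Rl R).
Local Notation hL := (hs_hopf L).
Local Notation inc := (hs_incl L).

Let aL_ex j : exists l, a j = inc l.
Proof. by apply/hs_image; rewrite -Rl_proj_a; exact: Rl_proj_in. Qed.

Definition leg_a (j : 'I_n) : L := sval (cid (aL_ex j)).

Lemma inc_leg_a j : inc (leg_a j) = a j.
Proof. by rewrite /leg_a; case: cid. Qed.

Definition leg_ret (x : H) : L := \sum_j (q j x : k) *: leg_a j.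

Lemma leg_ret_linear : linear leg_ret.
Proof. by rewrite /leg_ret; lin. Qed.

Lemma inc_leg_ret x : inc (leg_ret x) = Rl_proj x.
Proof.
rewrite /leg_ret linear_sum; apply: eq_bigr => j _.
by rewrite linearZ /= inc_leg_a.
Qed.

Lemma inc_Rl l : Rl R (inc l).
Proof. by apply/hs_image; exists l. Qed.

Lemma leg_retK l : leg_ret (inc l) = l.
Proof. by apply: (@hs_inj _ _ _ _ L); rewrite inc_leg_ret Rl_projE //; exact: inc_Rl. Qed.

Lemma leg_ret_a j : leg_ret (a j) = leg_a j.
Proof. by rewrite -inc_leg_a leg_retK. Qed.

Lemma leg_R_matrix : left_R_matrix hL hH inc leg_a b.
Proof.
have lr := leg_ret_linear.
have mc := morph_comul (hs_morph L).
have me := morph_counit (hs_morph L).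
split.
- move=> X F tF; pose G x y z := F (leg_ret x) (leg_ret y) z.
  have tG : trilin G by case: tF => l1 l2 l3; rewrite /G; trilin.
  have bG z : bilin (fun x y => G x y z) by case: tG => l1 l2 _; split=> *; [exact: l1|exact: l2].
  transitivity (\sum_j tlift (fun x y => G x y (b j)) (Δ (a j))).
    apply: eq_bigr => j _; rewrite -inc_leg_a mc tlift_tmap //.
    by apply: eq_tlift => x y; rewrite /G !leg_retK.
  rewrite (R_comul_l RR tG); apply: eq_bigr => j _; apply: eq_bigr => l _.
  by rewrite /G !leg_ret_a.
- move=> X F tF; pose G x y z := F (leg_ret x) y z.
  have tG : trilin G by case: tF => l1 l2 l3; rewrite /G; trilin.
  transitivity (\sum_j tlift (G (a j)) (Δ (b j))).
    by apply: eq_bigr => j _; apply: eq_tlift => x y; rewrite /G leg_ret_a.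
  rewrite (R_comul_r RR tG); apply: eq_bigr => j _; apply: eq_bigr => l _.
  by rewrite /G -!inc_leg_a -rmorphM leg_retK.
- move=> X F h bF; pose G x y := F (leg_ret x) y.
  have bG : bilin G by rewrite /G; lin.
  have := R_cocomm RR (inc h) bG; rewrite mc !tlift_tmap; [|by lin..].
  move=> E; transitivity (tlift (fun x y => \sum_j G (inc y * a j) (inc x * b j)) (comul hL h)).
    apply: eq_tlift => x y; apply: eq_bigr => j _.
    by rewrite /G -inc_leg_a -rmorphM leg_retK.
  rewrite E; apply: eq_tlift => x y; apply: eq_bigr => j _.
  by rewrite /G -inc_leg_a -rmorphM leg_retK.
- by rewrite -(R_counit_l RR); apply: eq_bigr => j _; rewrite -me inc_leg_a.
- apply: (@hs_inj _ _ _ _ L); rewrite rmorph1 -(R_counit_r RR) linear_sum.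
  by apply: eq_bigr => j _; rewrite linearZ /= inc_leg_a.
Qed.

Definition leg_antip_inv (l : L) : L := leg_ret (Rl_antip_inv (inc l)).

Lemma leg_antip_inv_linear : linear leg_antip_inv.
Proof.
exact: (linear_compose leg_ret_linear (linear_compose Rl_antip_inv_linear (linearP inc))).
Qed.

Lemma leg_antip_invK : cancel leg_antip_inv (antip hL).
Proof.
move=> l; apply: (@hs_inj _ _ _ _ L).
rewrite -(morph_antip (hs_morph L)) inc_leg_ret Rl_projE; last exact: Rl_antip_inv_in.
by rewrite Rl_antip_invK //; exact: inc_Rl.
Qed.

Lemma leg_antipK : cancel (antip hL) leg_antip_inv.
Proof.
move=> l; rewrite /leg_antip_inv -(morph_antip (hs_morph L)) Rl_antipK ?leg_retK //.
exact: inc_Rl.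
Qed.

Lemma leg_finite_dim : finite_dim L.
Proof.
pose f (l : L) : 'rV[k]_n := \row_j q j (inc l).
have lf : linear f by move=> c x y; apply/rowP => j; rewrite !mxE !linearP.
exists n, (linpack lf); exists (fun c : 'rV[k]_n => \sum_j c 0 j *: leg_a j) => [l|c] /=.
  by rewrite -[RHS]leg_retK; apply: eq_bigr => j _; rewrite mxE.
apply/rowP => m; rewrite mxE (linear_sum_at _ _ (linearP inc)).
rewrite (linear_sum_at _ _ (linearP (q m))).
rewrite -[RHS](sum_delta (fun j => c 0 j : k^o) m); apply: eq_bigr => j _.
rewrite (linearZ_at _ _ (linearP inc)) (linearZ_at _ _ (linearP (q m))).
have E : q m (inc (leg_a j)) = (j == m)%:R by rewrite inc_leg_a.
transitivity (c 0 j * (j == m)%:R); last exact: mulrC.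
exact: (congr1 ( *%R (c 0 j)) E).
Qed.

Lemma leg_hopf_algebroid (V : algType k) (aV : module_algebra hH V) :
  quantum_commutative R aV ->
  hopf_algebroid V (smash_product (restriction (hs_morph L) aV)).
Proof.
move=> qc.
have qcL (v w : V) : v * w =
    \sum_j act aV (b j) w * act (restriction (hs_morph L) aV) (leg_a j) v.
  rewrite qc tlift_sumE; last by lin.
  by apply: eq_bigr => j _; rewrite -inc_leg_a.
exact: (@smash_hopf_algebroid _ _ _ _ _ _ _ _ _ _ _ _ leg_R_matrix qcL
  (linpack leg_antip_inv_linear) leg_antipK leg_antip_invK).
Qed.

End Transfer.

End LeftLeg.

Theorem theorem5p8 (k : fieldType) (H : algType k) (hH : hopf_algebra H)
  (R : (H ⊗ H)%type) (qtR : quasitriangular hH R)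
  (V : algType k) (aV : module_algebra hH V) (qcV : quantum_commutative R aV) :
  inhabited (hopf_subalgebra hH (Rl R)) /\
  forall L : hopf_subalgebra hH (Rl R),
    finite_dim L /\
    inhabited (hopf_algebroid V (smash_product (restriction (hs_morph L) aV))).
Proof.
have [n [a [b [q [p [RE qa pb]]]]]] := tens_dual R; subst R.
split; first exact: (Rl_hopf_subalgebra qtR qa pb).
move=> L; split; first exact: (leg_finite_dim qa pb L).
by constructor; exact: (leg_hopf_algebroid qtR qa pb L qcV).
Qed.
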